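(* Let $R$ be a simply connected region in the triangular lattice admitting a lozenge tiling, and let $x$ be a lattice vertex of $R$. Let $c(x)$ denote the side length of the largest regular hexagon $S$ (a union of lattice triangles contained in $R$) centered at $x$ such that $R\setminus S$ remains tileable with lozenges. Then $$h_{\max}(x) - h_{\min}(x) = 3c(x).$$
   Context: The triangular lattice tiles the plane by unit equilateral triangles; upward-pointing triangles are black and downward-pointing triangles are white. A region $R$ is a finite simply connected union of such triangles; its points are its lattice vertices. A lozenge is the union of two adjacent triangles; an edge belongs to a lozenge tiling $T$ if it lies on the boundary of a lozenge of $T$. The height function $h_T$ of $T$ is an integer function on the vertices of $R$ such that for every edge $(x,y)$ belonging to $T$ having, when traversed from $x$ to $y$, a white triangle on its left, $h_T(x)-h_T(y)=1$; it is unique up to an additive constant, and all height functions are normalized to value $0$ at a fixed boundary vertex (so they agree on $\partial R$). $h_{\max}(x)$ and $h_{\min}(x)$ are the maximum and minimum of $h_T(x)$ over all lozenge tilings $T$ of $R$. *)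

(* Defs.v *)
From HB Require Import structures.
From mathcomp Require Import all_boot all_order all_algebra finmap.
From mathcomp Require Import all_classical all_reals topology normedtype.

Set Implicit Arguments.
Unset Strict Implicit.
Unset Printing Implicit Defensive.

Import Order.TTheory GRing.Theory Num.Theory.
Import numFieldNormedType.Exports.

Local Open Scope classical_set_scope.
Local Open Scope ring_scope.

(** The vertex [(a, b)] is the point [a e1 + b e2] of the plane, where
    [e1 = (1, 0)] and [e2 = (1/2, sqrt 3 / 2)]. *)
Notation vertex := (int * int)%type.

(** [(true, (a, b))] is the upward (black) triangle, and [(false, (a, b))] the
    downward (white) triangle, of the lattice parallelogram with lower left
    corner [(a, b)]. *)
Notation triangle := (bool * (int * int))%type.

Definition black (t : triangle) : bool := t.1.
Definition white (t : triangle) : bool := ~~ t.1.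

(** In counterclockwise order: the triangle is on the left of the edge going
    from each vertex to the next one. *)
Definition vertices (t : triangle) : seq vertex :=
  let: (c, (a, b)) := t in
  if c then [:: (a, b); (a + 1, b); (a, b + 1)]
  else [:: (a + 1, b); (a + 1, b + 1); (a, b + 1)].

Definition is_edge (t : triangle) (x y : vertex) : bool :=
  [&& x \in vertices t, y \in vertices t & x != y].

Definition adjacent (s t : triangle) : Prop :=
  s != t /\ exists x y, is_edge s x y /\ is_edge t x y.

Section Plane.
Variable R : realType.

Definition embed (v : vertex) : R * R :=
  (v.1%:~R + v.2%:~R / 2, v.2%:~R * (Num.sqrt 3 / 2)).

(** The closed triangle [t]: the convex hull of its three vertices. *)
Definition closed_triangle (t : triangle) : set (R * R) :=
  [set p | exists w : 'I_3 -> R,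
    [/\ forall i, 0 <= w i,
        \sum_i w i = 1,
        p.1 = \sum_i w i * (embed (nth (0, 0) (vertices t) i)).1
      & p.2 = \sum_i w i * (embed (nth (0, 0) (vertices t) i)).2]].

Definition carrier (D : {fset triangle}) : set (R * R) :=
  [set p | exists2 t, t \in D & closed_triangle t p].

Definition is_path (A : set (R * R)) (f : R -> R * R) (p q : R * R) : Prop :=
  [/\ {within `[0, 1], continuous f}, f @` `[0, 1] `<=` A, f 0 = p & f 1 = q].

Definition null_homotopic (A : set (R * R)) (f : R -> R * R) (p : R * R) :
    Prop :=
  exists H : R * R -> R * R,
    [/\ {within `[0, 1] `*` `[0, 1], continuous H},
        H @` (`[0, 1] `*` `[0, 1]) `<=` A,
        forall t, t \in `[0, 1] -> H (t, 0) = f t /\ H (t, 1) = p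
      & forall s, s \in `[0, 1] -> H (0, s) = p /\ H (1, s) = p].

Definition simply_connected (A : set (R * R)) : Prop :=
  [/\ A !=set0,
      forall p q, A p -> A q -> exists f, is_path A f p q
    & forall p f, is_path A f p p -> null_homotopic A f p].

End Plane.

Definition vertex_of (D : {fset triangle}) (v : vertex) : Prop :=
  exists2 t, t \in D & v \in vertices t.

(** The vertices of [D] lying on the topological boundary of its carrier. *)
Definition boundary_vertex (D : {fset triangle}) (v : vertex) : Prop :=
  vertex_of D v /\ exists2 t, t \notin D & v \in vertices t.

Definition is_lozenge (L : {fset triangle}) : Prop :=
  exists s t, adjacent s t /\ L = [fset s; t]%fset.

Definition is_tiling (D : {fset triangle}) (T : {fset {fset triangle}}) :
    Prop :=
  (forall L, L \in T -> is_lozenge L /\ (L `<=` D)%fset) /\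
  (forall t, t \in D -> exists! L, L \in T /\ t \in L).

Definition tileable (D : {fset triangle}) : Prop :=
  exists T, is_tiling D T.

(** An edge of a lozenge's triangles is on the boundary of the lozenge unless
    it is the edge shared by its two triangles. *)
Definition on_lozenge_boundary (L : {fset triangle}) (x y : vertex) : Prop :=
  exists! t, t \in L /\ is_edge t x y.

Definition edge_of_tiling (T : {fset {fset triangle}}) (x y : vertex) : Prop :=
  exists2 L, L \in T & on_lozenge_boundary L x y.

(** The white triangle on the left of an edge need not belong to the region. *)
Definition white_on_left (x y : vertex) : Prop :=
  exists t, [/\ white t, x \in vertices t & next (vertices t) x = y].

(** Only the values of [h] at the vertices of the tiled region matter. *)
Definition is_height_function (T : {fset {fset triangle}}) (h : vertex -> int) :
    Prop :=
  forall x y, edge_of_tiling T x y -> white_on_left x y -> h x - h y = 1.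

(** The values [h_T(x)], where [T] ranges over the tilings of [D] and [h_T] is
    normalized by [h_T(x0) = 0]. *)
Definition height_values (D : {fset triangle}) (x0 x : vertex) : set int :=
  [set m | exists T h,
    [/\ is_tiling D T, is_height_function T h, h x0 = 0 & h x = m]].

Definition is_maximum (d : Order.disp_t) (T : porderType d) (A : set T) (m : T)
    : Prop := A m /\ ubound A m.

Definition is_minimum (d : Order.disp_t) (T : porderType d) (A : set T) (m : T)
    : Prop := A m /\ lbound A m.

(** In lattice coordinates the regular hexagon with center [x] and side [k] is
    [|a| <= k, |b| <= k, |a + b| <= k], with [(a, b)] the displacement from
    [x]: its corners are [x] plus [k] times the six unit lattice vectors. For
    [k = 0] it contains no triangle. *)
Definition in_hexagon (x : vertex) (k : nat) (t : triangle) : bool :=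
  all (fun v : vertex =>
         [&& `|v.1 - x.1| <= k%:Z, `|v.2 - x.2| <= k%:Z
           & `|(v.1 - x.1) + (v.2 - x.2)| <= k%:Z]) (vertices t).

Definition removable_hexagons (D : {fset triangle}) (x : vertex) : set nat :=
  [set k | (forall t, in_hexagon x k t -> t \in D) /\
           tileable [fset t in D | ~~ in_hexagon x k t]%fset].

(* Main.v *)
(** A function on the vertices of [D] is a height function of some tiling iff
    it drops by 1 or by -2 along every edge having its white side on the left,
    and by 1 along the edges having only one side in [D]: the three drops around
    a triangle sum to 0, so exactly one of them is -2, and it tells the lozenge
    containing the triangle. These conditions are preserved by pointwise minimum
    and maximum.

    If two height functions [h1], [h2] agree on the boundary and
    [h1 x - h2 x = 3k], then [h1 - h2], which varies by at most 3 along an edge,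
    is positive at distance less than [k] from [x], so the hexagon [S] of side
    [k] lies in [D]. The median of [h1], [h2] and the steepest lattice height
    function with value [h2 x] at [x] is a height function that coincides with
    the latter on the boundary of [S]; hence its tiling splits along this
    boundary, and [S] is removable. Conversely, if [S] is removable, tile it so
    that the height on [S] is this steepest function; its values on [S] can be
    replaced by those of the opposite cone, which raises the height of [x] by
    [3k].

    Simple connectedness enters twice. Discretizing a null homotopy of a loop
    shows that closed 1-forms on [D] are exact, which gives the existence of
    heights. It also gives that heights agree on the boundary: the differential
    of [h1 - h2], extended by 0, is exact on the whole plane; if its
    primitive vanishing at infinity were not zero at some triangle outside [D],
    then the form dual to a ray issued from this triangle would be closed but
    not exact on [D]. *)

Require Import Defs.
From mathcomp Require Import all_boot all_order all_algebra finmap.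
From mathcomp Require Import all_classical all_reals topology normedtype.
From mathcomp Require Import zify ring lra.

Set Implicit Arguments.
Unset Strict Implicit.
Unset Printing Implicit Defensive.

Import Order.TTheory GRing.Theory Num.Theory.
Import numFieldNormedType.Exports.

Local Open Scope ring_scope.

(* [nb i t] is the triangle across the edge [i] of [t]. This edge goes from
   [src i t] to [dst i t], with its white triangle on the left, so that both are
   the same for [t] and for [nb i t]. *)
Inductive dir := D0 | D1 | D2.

Definition nb (i : dir) (t : triangle) : triangle :=
  let: (c, (a, b)) := t in
  match i with
  | D0 => if c then (false, (a - 1, b)) else (true, (a + 1, b))
  | D1 => (~~ c, (a, b))
  | D2 => if c then (false, (a, b - 1)) else (true, (a, b + 1))
  end.

Definition src (i : dir) (t : triangle) : vertex :=
  let: (c, (a, b)) := t in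
  match i with
  | D0 => if c then (a, b) else (a + 1, b)
  | D1 => (a, b + 1)
  | D2 => if c then (a + 1, b) else (a + 1, b + 1)
  end.

Definition dst (i : dir) (t : triangle) : vertex :=
  let: (c, (a, b)) := t in
  match i with
  | D0 => if c then (a, b + 1) else (a + 1, b + 1)
  | D1 => (a + 1, b)
  | D2 => if c then (a, b) else (a, b + 1)
  end.

Definition descent (h : vertex -> int) (i : dir) (t : triangle) : int :=
  h (src i t) - h (dst i t).


Lemma nbK i : involutive (nb i).
Proof. by case: i => -[[] [a b]] //=; rewrite ?addrK ?subrK. Qed.

Lemma nb_color i t : (nb i t).1 = ~~ t.1.
Proof. by case: i t => -[[] [a b]]. Qed.

Lemma nb_neq i t : t != nb i t.
Proof. by apply/eqP => e; have := nb_color i t; rewrite -e; case: t.1. Qed.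

Lemma src_nb i t : src i (nb i t) = src i t.
Proof. by case: i t => -[[] [a b]] //=; rewrite ?addrK ?subrK. Qed.

Lemma dst_nb i t : dst i (nb i t) = dst i t.
Proof. by case: i t => -[[] [a b]] //=; rewrite ?addrK ?subrK. Qed.

Lemma descent_nb h i t : descent h i (nb i t) = descent h i t.
Proof. by rewrite /descent src_nb dst_nb. Qed.

Lemma descent_sum h t : descent h D0 t + descent h D1 t + descent h D2 t = 0.
Proof. by rewrite /descent; case: t => -[] [a b] /=; ring. Qed.

Lemma src_vertex i t : src i t \in vertices t.
Proof. by case: i t => -[[] [a b]]; rewrite /= !inE eqxx ?orbT. Qed.

Lemma dst_vertex i t : dst i t \in vertices t.
Proof. by case: i t => -[[] [a b]]; rewrite /= !inE eqxx ?orbT. Qed.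

Lemma vertex_src v t : v \in vertices t -> exists i, v = src i t.
Proof.
by case: t => -[] [a b]; rewrite /= !inE => /or3P[] /eqP ->;
  [exists D0|exists D2|exists D1|exists D0|exists D2|exists D1].
Qed.

(** * Connectedness and exactness of closed forms *)

Section Lattice.
Variable R : realType.
Implicit Types (p q : R * R) (t : triangle) (v : vertex).

(* The point [p] is [lat_x p e1 + lat_y p e2]. *)
Definition lat_y p : R := p.2 / (Num.sqrt 3 / 2).
Definition lat_x p : R := p.1 - lat_y p / 2.

Lemma sqrt3_neq0 : (Num.sqrt 3 / 2 : R) != 0.
Proof. by rewrite gt_eqF// divr_gt0// sqrtr_gt0. Qed.

Lemma lat_y_embed v : lat_y (embed R v) = v.2%:~R.
Proof. by rewrite /lat_y /= mulfK// sqrt3_neq0. Qed.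

Lemma lat_x_embed v : lat_x (embed R v) = v.1%:~R.
Proof. by rewrite /lat_x lat_y_embed /= addrK. Qed.

(** An open hexagon around [v]; for [r = 1] it is the open star of [v], which meets only the
    triangles having [v] as a vertex. *)
Definition lat_within (r : R) v p :=
  [/\ `|lat_x p - v.1%:~R| < r, `|lat_y p - v.2%:~R| < r
    & `|lat_x p + lat_y p - (v.1 + v.2)%:~R| < r].

Lemma closed_triangle_lat t p : closed_triangle t p ->
  let: (c, (a, b)) := t in
  exists u w : R, [/\ 0 <= u, 0 <= w, u + w <= 1
    & if c then lat_x p = a%:~R + u /\ lat_y p = b%:~R + w
      else lat_x p = a%:~R + 1 - u /\ lat_y p = b%:~R + 1 - w].
Proof.
case: t => c [a b] [w [w0]].
rewrite !big_ord_recl !big_ord0 /=.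
set w1 := w ord0; set w2 := w _; set w3 := w _ => ws e1 e2.
have [h1 h2 h3] : [/\ 0 <= w1, 0 <= w2 & 0 <= w3] by split; apply: w0.
have ey : lat_y p = w1 * (nth (0, 0) (vertices (c, (a, b))) 0).2%:~R
  + w2 * (nth (0, 0) (vertices (c, (a, b))) 1).2%:~R
  + w3 * (nth (0, 0) (vertices (c, (a, b))) 2).2%:~R.
  rewrite /lat_y e2 /=; have := sqrt3_neq0.
  by set s := Num.sqrt 3 / 2 => s0; field.
have ex : lat_x p = w1 * (nth (0, 0) (vertices (c, (a, b))) 0).1%:~R
  + w2 * (nth (0, 0) (vertices (c, (a, b))) 1).1%:~R
  + w3 * (nth (0, 0) (vertices (c, (a, b))) 2).1%:~R.
  by rewrite /lat_x ey e1 /=; field.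
have ws' : w1 = 1 - w2 - w3 by lra.
case: c ex ey {e1 e2} => /=; rewrite !intrD ws' => ex ey.
  by exists w2, w3; split=> //; [lra|split; [rewrite ex|rewrite ey]; ring].
exists w3, w1; split=> //; first lra.
by split; [rewrite ex|rewrite ey]; rewrite ?ws'; ring.
Qed.

Lemma int_lt1 (z : int) : (-1 : R) < z%:~R -> z%:~R < (2 : R) -> z = 0 \/ z = 1.
Proof.
have -> : (-1 : R) = (-1)%:~R by [].
by rewrite -[(2 : R)]/((2 : int)%:~R) !ltr_int; lia.
Qed.

Lemma lat_within_vertex t v p :
  closed_triangle t p -> lat_within 1 v p -> v \in vertices t.
Proof.
move=> /closed_triangle_lat.
case: t => c [a b] [u [w [u0 w0 uw]]] H [].
have [d [e ->]] : exists d e, v = (a + d, b + e).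
  by case: v => v1 v2; exists (v1 - a), (v2 - b); congr pair; rewrite /= addrC subrK.
rewrite /= !intrD !ltr_norml.
move=> /andP[x1 x2] /andP[y1 y2] /andP[z1 z2].
have [d01 [e01 de]] : (d = 0 \/ d = 1) /\ (e = 0 \/ e = 1) /\
    if c then d + e != 2 else d + e != 0.
  split; [|split].
  - by apply: int_lt1; case: c H => -[Hx Hy]; lra.
  - by apply: int_lt1; case: c H => -[Hx Hy]; lra.
  - case: c H => -[Hx Hy]; apply/eqP => /(congr1 (fun z : int => z%:~R : R));
    by rewrite intrD; lra.
case: d01 e01 c de {H x1 x2 y1 y2 z1 z2} => -> [] -> [] //= _;
  by rewrite !inE ?addr0 eqxx ?orbT.
Qed.

(** Some vertex has barycentric weight at least 1/3, so [p] is within 2/3 of it in the hexagonal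
    norm. The bound 5/6 leaves a margin of 1/6 below 1, which absorbs two coordinate errors of 1/12
    in [lat_within_near]. *)
Lemma lat_within_exists t p : closed_triangle t p ->
  exists2 v, v \in vertices t & lat_within (5 / 6) v p.
Proof.
move=> /closed_triangle_lat.
case: t => -[] [a b] [u [w [u0 w0 uw]]] [Hx Hy].
- have [h|h] := lerP (2 / 3) u.
    exists (a + 1, b); rewrite /= ?inE ?eqxx ?orbT//.
    by rewrite /lat_within Hx Hy /= !intrD; split; rewrite ltr_norml; lra.
  have [h'|h'] := lerP (2 / 3) w.
    exists (a, b + 1); rewrite /= ?inE ?eqxx ?orbT//.
    by rewrite /lat_within Hx Hy /= !intrD; split; rewrite ltr_norml; lra.
  have [h2|h2] := lerP (u + w) (2 / 3).
    exists (a, b); rewrite /= ?inE ?eqxx ?orbT//.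
    by rewrite /lat_within Hx Hy /= !intrD; split; rewrite ltr_norml; lra.
  have [h3|h3] := lerP u w.
    exists (a, b + 1); rewrite /= ?inE ?eqxx ?orbT//.
    by rewrite /lat_within Hx Hy /= !intrD; split; rewrite ltr_norml; lra.
  exists (a + 1, b); rewrite /= ?inE ?eqxx ?orbT//.
  by rewrite /lat_within Hx Hy /= !intrD; split; rewrite ltr_norml; lra.
- have [h|h] := lerP (2 / 3) u.
    exists (a, b + 1); rewrite /= ?inE ?eqxx ?orbT//.
    by rewrite /lat_within Hx Hy /= !intrD; split; rewrite ltr_norml; lra.
  have [h'|h'] := lerP (2 / 3) w.
    exists (a + 1, b); rewrite /= ?inE ?eqxx ?orbT//.
    by rewrite /lat_within Hx Hy /= !intrD; split; rewrite ltr_norml; lra.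
  have [h2|h2] := lerP (u + w) (2 / 3).
    exists (a + 1, b + 1); rewrite /= ?inE ?eqxx ?orbT//.
    by rewrite /lat_within Hx Hy /= !intrD; split; rewrite ltr_norml; lra.
  have [h3|h3] := lerP u w.
    exists (a + 1, b); rewrite /= ?inE ?eqxx ?orbT//.
    by rewrite /lat_within Hx Hy /= !intrD; split; rewrite ltr_norml; lra.
  exists (a, b + 1); rewrite /= ?inE ?eqxx ?orbT//.
  by rewrite /lat_within Hx Hy /= !intrD; split; rewrite ltr_norml; lra.
Qed.

Lemma lat_within_near v p q :
  lat_within (5 / 6) v p -> `|lat_x p - lat_x q| < 1 / 12 ->
  `|lat_y p - lat_y q| < 1 / 12 -> lat_within 1 v q.
Proof.
rewrite /lat_within intrD !ltr_norml => -[] /andP[? ?] /andP[? ?] /andP[? ?].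
by move=> /andP[? ?] /andP[? ?]; split; lra.
Qed.

Lemma lat_within_embed u v : lat_within (5 / 6) v (embed R u) -> v = u.
Proof.
case: u v => [a b] [c d]; rewrite /lat_within lat_x_embed lat_y_embed /=.
rewrite -!intrB -!intr_norm => -[h1 h2 _].
have lt1 (z : int) : (z%:~R : R) < 5 / 6 -> z < 1.
  by move=> hz; rewrite -(ltr_int R); lra.
by move/lt1: h1; move/lt1: h2 => h2 h1; congr pair; lia.
Qed.

Lemma closed_triangle_embed t v : v \in vertices t -> closed_triangle t (embed R v).
Proof.
case: t => -[] [a b]; rewrite /= !inE => /or3P[] /eqP ->;
 [exists (fun i => if i == 0 then 1 else 0)
 |exists (fun i => if i == 1 then 1 else 0)
 |exists (fun i => if i == 2%:R then 1 else 0)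
 |exists (fun i => if i == 0 then 1 else 0)
 |exists (fun i => if i == 1 then 1 else 0)
 |exists (fun i => if i == 2%:R then 1 else 0)];
 (split; [by move=> i; case: ifP|
   by rewrite !big_ord_recl big_ord0 /= ?add0r ?addr0|
   by rewrite !big_ord_recl big_ord0 /= ?mul1r ?mul0r ?add0r ?addr0|
   by rewrite !big_ord_recl big_ord0 /= ?mul1r ?mul0r ?add0r ?addr0]).
Qed.

Lemma closed_triangle_convex t p q (s : R) : 0 <= s <= 1 ->
  closed_triangle t p -> closed_triangle t q ->
  closed_triangle t (p.1 + s * (q.1 - p.1), p.2 + s * (q.2 - p.2)).
Proof.
move=> /andP[s0 s1] [w [w0 ws wx wy]] [w' [w0' ws' wx' wy']].
have lin (F : 'I_3 -> R) : \sum_i (w i + s * (w' i - w i)) * F i =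
  \sum_i w i * F i + s * (\sum_i w' i * F i - \sum_i w i * F i).
  by rewrite -sumrB mulr_sumr -big_split; apply: eq_bigr => i _ /=; ring.
exists (fun i => w i + s * (w' i - w i)); split.
- move=> i; have := w0 i; have := w0' i.
  have -> : w i + s * (w' i - w i) = (1 - s) * w i + s * w' i by ring.
  by move=> ? ?; rewrite addr_ge0// mulr_ge0// subr_ge0.
- by rewrite big_split -mulr_sumr sumrB ws ws' subrr mulr0 [LHS]addr0.
- by rewrite /= lin wx wx'.
- by rewrite /= lin wy wy'.
Qed.

Lemma lat_y_continuous : continuous lat_y.
Proof.
move=> p; apply: (@continuousM _ _ (fun p : R * R => p.2) (fun=> _)).
  exact: cvg_snd.
exact: cst_continuous.
Qed.

Lemma lat_x_continuous : continuous lat_x.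
Proof.
move=> p; apply: (@continuousB _ R^o _ (fun p : R * R => p.1) (fun p => lat_y p / 2)).
  exact: cvg_fst.
apply: (@continuousM _ _ lat_y (fun=> _)); first exact: lat_y_continuous.
exact: cst_continuous.
Qed.

(** Heine-Cantor, from the near-covering form of compactness applied to the filter of radii tending
    to 0 from above. *)
Lemma uniformly_continuous_compact (T : pseudoMetricType R) (K : set T)
    (f : T -> R) (e : R) :
  compact K -> {within K, continuous f}%classic -> 0 < e ->
  exists2 d : R, 0 < d & forall x y, K x -> K y -> ball x d y -> `|f x - f y| < e.
Proof.
move=> cK cf e0.
have := (compact_near_coveringP K).1 cK R (0^'+)%classic
  (fun d x => K x -> forall y, K y -> ball x d y -> `|f x - f y| < e) _.
case.
  move=> x Kx.
  move/subspace_continuousP/(_ x Kx): cf => /cvgrPdist_lt /(_ (e / 2)).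
  have e2 : 0 < e / 2 by rewrite divr_gt0.
  move=> /(_ e2); rewrite /within /=.
  (* With [x'] within [r / 2] of [x] and [d < r / 2], both [x'] and [y] stay within [r] of [x]. *)
  rewrite -nbhs_ballE => -[r /= r0 hr].
  exists (ball x (r / 2), [set d : R | 0 < d < r / 2])%classic => /=.
    split; first exact: nbhsx_ballx (divr_gt0 r0 _).
    near=> d; apply/andP; split; first by near: d; exact: nbhs_right_gt.
    by near: d; apply: nbhs_right_lt; rewrite divr_gt0.
  move=> [x' d] /= [bx' /andP[d0 dr]] Kx' y Ky bxy.
  have rr : r / 2 <= r by rewrite ler_pdivrMr// mulr_natr mulr2n lerDl ltW.
  have h1 := hr x' (le_ball rr bx') Kx'.
  have bxy' : ball x r y.
    by rewrite [r]splitr; apply: ball_triangle bx' (le_ball (ltW dr) bxy).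
  have h2 := hr y bxy' Ky.
  have := ltrD h1 h2; rewrite -splitr; apply: le_lt_trans.
  by rewrite [X in _ <= X + _]distrC; apply: ler_distD.
move=> d /= d0 hd; exists (d / 2); first by rewrite divr_gt0.
move=> x y Kx Ky; apply: (hd (d / 2)) => //=; last by rewrite divr_gt0.
by rewrite sub0r normrN gtr0_norm ?divr_gt0// ltr_pdivrMr// mulr_natr mulr2n ltrDl.
Unshelve. all: by end_near.
Qed.

Definition lat_close p q :=
  `|lat_x p - lat_x q| < 1 / 12 /\ `|lat_y p - lat_y q| < 1 / 12.

Lemma lat_close_refl p : lat_close p p.
Proof. by rewrite /lat_close !subrr normr0; split; lra. Qed.

(** The factor 2 in the radius puts neighbours on a grid of step at most [1 / m] strictly inside the
    open ball. *)
Lemma fine_subdivision (T : pseudoMetricType R) (K : set T) (f : T -> R * R) :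
  compact K -> {within K, continuous f}%classic ->
  exists2 m : nat, (0 < m)%N &
    forall x y, K x -> K y -> ball x (2 / m%:R) y -> lat_close (f x) (f y).
Proof.
move=> cK cf.
have e0 : (0 : R) < 1 / 12 by lra.
have [d1 d10 h1] : exists2 d : R, 0 < d & forall x y, K x -> K y -> ball x d y ->
    `|lat_x (f x) - lat_x (f y)| < 1 / 12.
  apply: (@uniformly_continuous_compact T K (lat_x \o f)) => //.
  by move=> x; apply: (@continuous_comp (subspace K) _ _ f lat_x x);
    [exact: cf|exact: lat_x_continuous].
have [d2 d20 h2] : exists2 d : R, 0 < d & forall x y, K x -> K y -> ball x d y ->
    `|lat_y (f x) - lat_y (f y)| < 1 / 12.
  apply: (@uniformly_continuous_compact T K (lat_y \o f)) => //.
  by move=> x; apply: (@continuous_comp (subspace K) _ _ f lat_y x);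
    [exact: cf|exact: lat_y_continuous].
pose d := Num.min d1 d2.
have d0 : 0 < d by rewrite lt_min d10 d20.
have [m hm] : exists m : nat, 2 / d < m%:R.
  by exists (Num.Def.archi_bound (2 / d)); apply: archi_boundP; rewrite divr_ge0// ltW.
have m0 : 0 < (m%:R : R) by apply: lt_trans hm; rewrite divr_gt0.
exists m; first by rewrite -(ltr_nat R).
have le_d : 2 / m%:R <= d.
  by rewrite ler_pdivrMr// mulrC -ler_pdivrMr// ltW.
move=> x y Kx Ky bxy; split.
  by apply: h1 => //; apply: le_ball bxy; rewrite (le_trans le_d)// ge_min lexx.
by apply: h2 => //; apply: le_ball bxy; rewrite (le_trans le_d)// ge_min lexx orbT.
Qed.

(* The truncation of [x] to [[0, 1]], in a visibly continuous form. *)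
Definition clamp (x : R) := (`|x| - `|x - 1| + 1) / 2.

Lemma clamp_le0 x : x <= 0 -> clamp x = 0.
Proof. by move=> x0; rewrite /clamp !ler0_norm; lra. Qed.

Lemma clamp_ge1 x : 1 <= x -> clamp x = 1.
Proof. by move=> x0; rewrite /clamp !ger0_norm; lra. Qed.

Lemma clamp_id x : 0 <= x <= 1 -> clamp x = x.
Proof. by move=> x0; rewrite /clamp ger0_norm ?ler0_norm; lra. Qed.

Lemma clamp_continuous : continuous clamp.
Proof.
move=> x; apply: (@continuousM R R (fun x : R => `|x| - `|x - 1| + 1) (fun=> 2^-1));
  last exact: cst_continuous.
apply: (@continuousD _ R^o _ (fun x : R => `|x| - `|x - 1|) (fun=> _));
  last exact: cst_continuous.
apply: (@continuousB _ R^o _ (fun x : R => `|x|) (fun x => `|x - 1|)).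
  exact: norm_continuous.
apply: (@continuous_comp _ _ _ (fun x : R => x - 1) (fun x => `|x|)).
  by apply: (@continuousB _ R^o _ id (fun=> _)); [|exact: cst_continuous].
exact: norm_continuous.
Qed.

(** Interpolation of [c] at the integers, written as a sum of clamped ramps so that continuity needs
    no gluing. *)
Fixpoint piecewise_linear (c : nat -> R) (n : nat) (x : R) : R :=
  if n is n'.+1 then
    piecewise_linear c n' x + clamp (x - n'%:R) * (c n'.+1 - c n')
  else c 0.

Lemma piecewise_linear_continuous c n : continuous (piecewise_linear c n).
Proof.
elim: n => [|n IHn] x /=; first exact: cst_continuous.
apply: (@continuousD _ R^o _ (piecewise_linear c n)
  (fun x => clamp (x - n%:R) * (c n.+1 - c n))); first exact: IHn.
apply: (@continuousM R R (fun x => clamp (x - n%:R)) (fun=> c n.+1 - c n));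
  last exact: cst_continuous.
apply: (@continuous_comp _ _ _ (fun x : R => x - n%:R) clamp).
  by apply: (@continuousB _ R^o _ id (fun=> _)); [|exact: cst_continuous].
exact: clamp_continuous.
Qed.

Lemma piecewise_linear_end c n x : n%:R <= x -> piecewise_linear c n x = c n.
Proof.
elim: n => [|n IHn] //= nx; rewrite IHn; last first.
  by apply: le_trans nx; rewrite ler_nat.
by rewrite clamp_ge1; [rewrite mul1r addrC subrK|rewrite lerBrDr addrC natr1].
Qed.

Lemma piecewise_linear_segment c n j x : (j < n)%N -> j%:R <= x <= j.+1%:R ->
  piecewise_linear c n x = c j + (x - j%:R) * (c j.+1 - c j).
Proof.
elim: n => [|n IHn] //; rewrite ltnS leq_eqVlt => /orP[/eqP ->|jn] /andP[jx xj] /=.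
  rewrite piecewise_linear_end// clamp_id//.
  by rewrite subr_ge0 jx /= lerBlDl natr1.
rewrite IHn ?jx// clamp_le0 ?mul0r ?addr0// subr_le0.
by rewrite (le_trans xj)// ler_nat.
Qed.

(** * Discretization of paths and homotopies *)

Section Region.
Variable D : {fset triangle}.

(* As in simplicial approximation: points close to a point of a triangle have
   their nearest vertex among the vertices of this triangle. *)
Lemma nearest_vertex : exists V : R * R -> vertex,
  [/\ forall v, V (embed R v) = v,
      forall t p, t \in D -> closed_triangle t p -> V p \in vertices t
    & forall p, carrier D p -> exists2 t, t \in D &
        forall q, carrier D q -> lat_close p q -> V q \in vertices t].
Proof.
(* Lattice points are included even off the carrier, so that [V (embed R v) = v] holds for all [v];
   elsewhere the value is arbitrary. *)
have hex p : exists v, carrier D p \/ (exists u, p = embed R u) -> lat_within (5 / 6) v p.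
  have [[[t tD /lat_within_exists[v _ hv]]|[u ->]]|nC] :=
    pselect (carrier D p \/ (exists u, p = embed R u)).
  - by exists v.
  - exists u; rewrite /lat_within lat_x_embed lat_y_embed intrD !subrr normr0 => _.
    by split; lra.
  - by exists (0, 0).
have [V hV] := choice hex; exists V; split.
- by move=> v; apply: lat_within_embed; apply: hV; right; exists v.
- move=> t p tD tp; apply: lat_within_vertex (tp) _.
  have Cp : carrier D p by exists t.
  by apply: lat_within_near (hV _ (or_introl Cp)) _ _; rewrite subrr normr0; lra.
- move=> p [t tD tp]; exists t => // q Cq [cx cy].
  apply: lat_within_vertex (tp) _.
  by apply: lat_within_near (hV _ (or_introl Cq)) _ _; rewrite distrC.
Qed.

Lemma grid_in (i N : nat) : (i <= N)%N -> (`[0, 1]%classic : set R) (i%:R / N%:R).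
Proof.
move=> iN; rewrite /= in_itv /=; case: N iN => [|N] iN.
  by rewrite invr0 mulr0 lexx ler01.
by rewrite divr_ge0//= ler_pdivrMr// mul1r ler_nat.
Qed.

Lemma grid_ball (i N m : nat) : (0 < m)%N -> (m <= N)%N ->
  ball (i%:R / N%:R : R) (2 / m%:R) (i.+1%:R / N%:R).
Proof.
move=> m0 mN; have N0 := leq_trans m0 mN.
rewrite /ball /= -mulrBl -natr1 opprD addNKr mulN1r normrN.
rewrite gtr0_norm ?invr_gt0 ?ltr0n//.
rewrite -[X in X < _]mul1r ltr_pdivrMr ?ltr0n// mulrAC ltr_pdivlMr ?ltr0n//.
rewrite mul1r mulr_natl mulr2n (@le_lt_trans _ _ N%:R) ?ler_nat//.
by rewrite ltrDl ltr0n.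
Qed.

(** Connectedness in discrete form: along a finely sampled path in the carrier, successive nearest
    vertices share a triangle of [D], so [P] propagates from one sample to the next. *)
Lemma vertex_ind (P : vertex -> Prop) (u v : vertex) :
  (forall p q, carrier D p -> carrier D q -> exists f : R -> R * R, is_path (carrier D) f p q) ->
  (forall t x y, t \in D -> x \in vertices t -> y \in vertices t -> P x -> P y) ->
  vertex_of D u -> vertex_of D v -> P u -> P v.
Proof.
move=> pc hP [t tD ut] [s sD vs] Pu.
have [f [cf fD f0 f1]] := pc (embed R u) (embed R v)
  (ex_intro2 _ _ t tD (closed_triangle_embed ut))
  (ex_intro2 _ _ s sD (closed_triangle_embed vs)).
have [V [Ve _ Vs]] := nearest_vertex.
have [m m0 hm] := fine_subdivision (segment_compact (a := 0) (b := 1)) cf.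
have fC i : (i <= m)%N -> carrier D (f (i%:R / m%:R)).
  by move=> im; apply: fD; exists (i%:R / m%:R) => //; exact: grid_in.
suff H i : (i <= m)%N -> P (V (f (i%:R / m%:R))).
  by rewrite -[v]Ve -f1 -(@divff _ m%:R) ?pnatr_eq0 -?lt0n//; exact: H.
elim: i => [_|i IHi im]; first by rewrite mul0r f0 Ve.
have [r rD hr] := Vs _ (fC i (ltnW im)).
apply: hP rD _ _ (IHi (ltnW im)).
  by apply: hr; [exact/fC/ltnW|exact: lat_close_refl].
apply: hr; first exact: fC.
by apply: hm; [exact/grid_in/ltnW|exact: grid_in|exact: grid_ball].
Qed.

Section Loop.
(** A closed discrete 1-form. Degenerate triples are allowed in the cocycle condition, which
    therefore yields antisymmetry and vanishing on the diagonal. *)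
Variable omega : vertex -> vertex -> int.
Hypothesis omega_triangle : forall t (u v x : vertex), t \in D ->
  u \in vertices t -> v \in vertices t -> x \in vertices t ->
  omega u v + omega v x = omega u x.

Lemma omega_refl t u : t \in D -> u \in vertices t -> omega u u = 0.
Proof. by move=> tD ut; have := omega_triangle tD ut ut ut; lia. Qed.

Definition is_chain (c : nat -> vertex) (n : nat) :=
  forall i, (i < n)%N ->
    exists t, [/\ t \in D, c i \in vertices t & c i.+1 \in vertices t].

Definition chain_path (c : nat -> vertex) (n : nat) (s : R) : R * R :=
  (piecewise_linear (fun i => (embed R (c i)).1) n (n%:R * s),
   piecewise_linear (fun i => (embed R (c i)).2) n (n%:R * s)).

Lemma chain_path_continuous c n : continuous (chain_path c n).
Proof.
move=> /= s.
have pl (g : nat -> R) : {for s, continuous (fun s : R => piecewise_linear g n (n%:R * s))}.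
  apply: (@continuous_comp R R R (fun x : R => n%:R * x)).
    by apply: (@continuousM R R (fun=> n%:R) id) => //; exact: cst_continuous.
  exact: piecewise_linear_continuous.
exact: (cvg_pair (pl _) (pl _)).
Qed.

Lemma chain_path_segment c n j s : (j < n)%N -> j%:R <= n%:R * s <= j.+1%:R ->
  forall t, t \in D -> c j \in vertices t -> c j.+1 \in vertices t ->
  closed_triangle t (chain_path c n s).
Proof.
move=> jn js t tD ct ct'; rewrite /chain_path !(piecewise_linear_segment _ jn js).
apply: closed_triangle_convex; try exact: closed_triangle_embed.
by rewrite subr_ge0 lerBlDl natr1.
Qed.

Lemma chain_path_carrier c n s : (0 < n)%N -> is_chain c n -> 0 <= s <= 1 ->
  carrier D (chain_path c n s).
Proof.
move=> n0 hc /andP[s0 s1].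
have [j jn js] : exists2 j, (j < n)%N & j%:R <= n%:R * s <= j.+1%:R.
  have : n%:R * s <= n%:R by rewrite ler_piMr.
  elim: n n0 {hc} (n%:R * s) (mulr_ge0 (ler0n R n) s0) => // n IHn _ x x0 xn.
  have [h|h] := lerP n%:R x; first by exists n; rewrite // h.
  case: n IHn h xn => [|n] IHn h xn; first by rewrite ltNge x0 in h.
  by have [j jn ?] := IHn isT _ x0 (ltW h); exists j => //; rewrite ltnW.
have [t [tD ct ct']] := hc j jn.
by exists t => //; exact: chain_path_segment jn js t tD ct ct'.
Qed.

(** With [m] samples per segment, the ends of the segments are grid points. All samples of one
    segment have their vertices in one triangle of [D], where the cocycle condition collapses the
    sum to a single term. *)
Lemma chain_sum_grid (V : R * R -> vertex) c n m :
  (forall v, V (embed R v) = v) ->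
  (forall t p, t \in D -> closed_triangle t p -> V p \in vertices t) ->
  (0 < m)%N -> (0 < n)%N -> is_chain c n ->
  \sum_(i < n * m) omega (V (chain_path c n (i%:R / (n * m)%:R)))
    (V (chain_path c n (i.+1%:R / (n * m)%:R))) =
  \sum_(i < n) omega (c i) (c i.+1).
Proof.
move=> Ve Vt m0 n0 hc.
pose X k := V (chain_path c n (k%:R / (n * m)%:R)).
have nk k : n%:R * (k%:R / (n * m)%:R) = k%:R / m%:R :> R.
  by rewrite natrM; field; rewrite !pnatr_eq0 -!lt0n m0.
have Xm j : (j <= n)%N -> X (j * m)%N = c j.
  move=> jn; rewrite /X -[RHS]Ve; congr V; rewrite /chain_path nk natrM mulfK; last first.
    by rewrite pnatr_eq0 -lt0n.
  move: jn; rewrite leq_eqVlt => /orP[/eqP ->|jn].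
    by rewrite !piecewise_linear_end//; case: embed.
  rewrite !(piecewise_linear_segment _ jn) ?lexx ?ler_nat ?leqnSn//.
  by rewrite subrr !mul0r !addr0; case: embed.
have step : forall j r, (j < n)%N -> (r <= m)%N ->
    \sum_(i < j * m + r) omega (X i) (X i.+1) =
    \sum_(i < j * m) omega (X i) (X i.+1) + omega (c j) (X (j * m + r)%N).
  move=> j r jn; have [t [tD ct ct']] := hc j jn.
  have Xt r' : (r' <= m)%N -> X (j * m + r')%N \in vertices t.
    move=> rm; apply: Vt => //; apply: chain_path_segment jn _ t tD ct ct'.
    rewrite nk ler_pdivlMr ?ltr0n// ler_pdivrMr ?ltr0n// -!natrM !ler_nat.
    by rewrite leq_addr mulSn addnC leq_add2r.
  elim: r => [_|r IHr rm].
    by rewrite addn0 Xm ?(ltnW jn)// (omega_refl tD ct) addr0.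
  rewrite addnS big_ord_recr /= IHr ?(ltnW rm)// -addrA; congr (_ + _).
  by apply: omega_triangle tD _ _ _; rewrite -?addnS ?Xt ?(ltnW rm).
have H k : (k <= n)%N -> \sum_(i < k * m) omega (X i) (X i.+1) =
    \sum_(i < k) omega (c i) (c i.+1); last exact: H.
elim: k => [_|j IHj jn]; first by rewrite !big_ord0.
rewrite mulSn addnC step// IHj ?(ltnW jn)// big_ord_recr /=; congr (_ + omega _ _).
by rewrite addnC -mulSn Xm.
Qed.

(** A null homotopy is sampled on a square grid so fine that the corners of each cell map into one
    triangle of [D]. Closedness on the cells makes all row sums equal, since the lateral sides stay
    at the base point; the first row gives the loop and the last row is constant. *)
Lemma null_loop_sum c n : simply_connected (@carrier R D) ->
  is_chain c n -> c n = c 0%N -> \sum_(i < n) omega (c i) (c i.+1) = 0.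
Proof.
move=> [_ _ sc] hc cn; case: (posnP n) => [->|n0]; first by rewrite big_ord0.
have [V [Ve Vt Vs]] := nearest_vertex.
pose f := chain_path c n; pose p := embed R (c 0%N).
have pf : is_path (carrier D) f p p.
  split.
  - by apply: continuous_subspaceT; exact: chain_path_continuous.
  - move=> _ [s /= s01 <-]; exact: chain_path_carrier.
  - rewrite /f /chain_path mulr0 !(piecewise_linear_segment _ n0) ?lexx ?ler01//.
    by rewrite subrr !mul0r !addr0 /p; case: embed.
  - rewrite /f /chain_path mulr1 !piecewise_linear_end// cn /p; by case: embed.
have [H [cH HD Hf Hp]] := sc p f pf.
have [m m0 hm] := fine_subdivision
  (compact_setX (segment_compact (a := 0) (b := 1)) (segment_compact (a := 0) (b := 1))) cH.
(* A multiple of [n], so that [chain_sum_grid] applies to the first row, and at least [m], so that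
   the cells are small enough. *)
pose N := (n * m)%N.
have mN : (m <= N)%N by rewrite leq_pmull.
have N0 : (0 < N)%N by apply: leq_trans mN.
pose g (i : nat) : R := i%:R / N%:R.
pose X i j := V (H (g i, g j)).
have sq i j : (i <= N)%N -> (j <= N)%N -> (`[0, 1] `*` `[0, 1])%classic (g i, g j).
  by move=> iN jN; split; exact: grid_in.
have cr i j : (i <= N)%N -> (j <= N)%N -> carrier D (H (g i, g j)).
  by move=> iN jN; apply: HD; exists (g i, g j) => //; exact: sq.
have cell i j : (i < N)%N -> (j < N)%N ->
    omega (X i j) (X i.+1 j) + omega (X i.+1 j) (X i.+1 j.+1) =
    omega (X i j) (X i j.+1) + omega (X i j.+1) (X i.+1 j.+1).
  move=> iN jN; have [t tD ht] := Vs _ (cr i j (ltnW iN) (ltnW jN)).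
  have r0 : 0 < 2 / m%:R :> R by rewrite divr_gt0// ltr0n.
  have Xt i' j' : (i' == i) || (i' == i.+1) -> (j' == j) || (j' == j.+1) ->
      X i' j' \in vertices t.
    move=> hi hj.
    have iN' : (i' <= N)%N by case/orP: hi => /eqP ->; lia.
    have jN' : (j' <= N)%N by case/orP: hj => /eqP ->; lia.
    apply: ht; first exact: cr.
    apply: hm; [exact: sq (ltnW iN) (ltnW jN)|exact: sq|].
    split => /=.
      by case/orP: hi => /eqP ->; [exact: ballxx|exact: grid_ball].
    by case/orP: hj => /eqP ->; [exact: ballxx|exact: grid_ball].
  by rewrite !(omega_triangle tD) // Xt ?eqxx ?orbT.
have gN : g N = 1 by rewrite /g divff// pnatr_eq0 -lt0n.
have g0 : g 0%N = 0 by rewrite /g mul0r.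
have gI i : (i <= N)%N -> g i \in `[0, 1] by move=> iN; exact: grid_in.
have row j : (j < N)%N ->
    \sum_(i < N) omega (X i j) (X i.+1 j) = \sum_(i < N) omega (X i j.+1) (X i.+1 j.+1).
  move=> jN; apply/eqP; rewrite -subr_eq0 -sumrB; apply/eqP.
  have tele k : (k <= N)%N ->
      \sum_(i < k) (omega (X i j) (X i.+1 j) - omega (X i j.+1) (X i.+1 j.+1)) =
      omega (X 0%N j) (X 0%N j.+1) - omega (X k j) (X k j.+1).
    elim: k => [_|k IHk kN]; first by rewrite big_ord0 subrr.
    by rewrite big_ord_recr /= IHk ?(ltnW kN)//; have := cell k j kN jN; lia.
  rewrite tele// /X gN g0.
  have [-> ->] := Hp _ (gI j (ltnW jN)).
  by have [-> ->] := Hp _ (gI j.+1 jN); rewrite subrr.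
have rows j : (j <= N)%N ->
    \sum_(i < N) omega (X i 0%N) (X i.+1 0%N) = \sum_(i < N) omega (X i j) (X i.+1 j).
  by elim: j => // j IHj jN; rewrite IHj ?(ltnW jN)// row.
rewrite -(chain_sum_grid Ve Vt m0 n0 hc).
transitivity (\sum_(i < N) omega (X i 0%N) (X i.+1 0%N)).
  apply: eq_bigr => i _; rewrite /X g0.
  by have [-> _] := Hf _ (gI i (ltnW (ltn_ord i))); have [-> _] := Hf _ (gI i.+1 (ltn_ord i)).
rewrite (rows N)// big1// => i _; rewrite /X gN.
have [_ ->] := Hf _ (gI i (ltnW (ltn_ord i))); have [_ ->] := Hf _ (gI i.+1 (ltn_ord i)).
have [t [tD ct _]] := hc 0%N n0.
by rewrite /p Ve; exact: omega_refl tD ct.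
Qed.

(** The potential is the integral of [omega] along a chain from a base vertex. Retracing a second
    chain backwards closes a loop, so [null_loop_sum] gives independence of the chain. *)
Lemma potential : simply_connected (@carrier R D) ->
  exists F : vertex -> int, forall t u v, t \in D ->
    u \in vertices t -> v \in vertices t -> omega u v = F v - F u.
Proof.
move=> sc; have [[p [t0 t0D _]] pc _] := sc.
pose u0 := src D0 t0.
pose reach v z := exists c n, [/\ is_chain c n, c 0%N = u0, c n = v &
  \sum_(i < n) omega (c i) (c i.+1) = z].
have reach_step t v w z : t \in D -> v \in vertices t -> w \in vertices t ->
    reach v z -> reach w (z + omega v w).
  move=> tD vt wt [c [n [hc c0 cn <-]]].
  exists (fun i => if (i <= n)%N then c i else w), n.+1; split => //.
  - move=> i; rewrite ltnS leq_eqVlt => /orP[/eqP ->|iln].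
      by rewrite eqxx ltnn cn; exists t.
    by rewrite iln orbT; exact: hc.
  - by rewrite ltnn.
  - rewrite big_ord_recr /= leqnn ltnn cn; congr (_ + _).
    by apply: eq_bigr => i _; rewrite (ltnW (ltn_ord i)) (ltn_ord i).
have reach_ex v : vertex_of D v -> exists z, reach v z.
  move=> vD; apply: (@vertex_ind (fun v => exists z, reach v z) u0 v pc _ _ vD).
  - by move=> t x y tD xt yt [z hz]; exists (z + omega x y); exact: reach_step tD xt yt hz.
  - by exists t0 => //; exact: src_vertex.
  - by exists 0, (fun=> u0), 0%N; split => //; rewrite big_ord0.
have reach_back c n z : is_chain c n -> reach (c n) z ->
    reach (c 0%N) (z - \sum_(i < n) omega (c i) (c i.+1)).
  elim: n z => [|n IHn] z hc hr; first by rewrite big_ord0 subr0.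
  have [t [tD ct ct']] := hc n (ltnSn n).
  rewrite big_ord_recr /= opprD addrA addrAC.
  have hc' : is_chain c n by move=> i iltn; exact: hc (ltnW iltn).
  have -> : z - omega (c n) (c n.+1) = z + omega (c n.+1) (c n).
    by have := omega_triangle tD ct ct' ct; rewrite (omega_refl tD ct); lia.
  by apply: IHn => //; exact: reach_step tD ct' ct hr.
have reach_uniq v z z' : reach v z -> reach v z' -> z = z'.
  move=> hr [c [n [hc c0 cn s]]].
  rewrite -cn in hr; have := reach_back c n z hc hr.
  rewrite s c0 => -[c' [n' [hc' c0' cn' s']]].
  have := null_loop_sum sc hc' (etrans cn' (esym c0')); lia.
have [F hF] : exists F, forall v, vertex_of D v -> reach v (F v).
  have /choice[F hF] : forall v, exists z, vertex_of D v -> reach v z.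
    move=> v; have [/reach_ex[z hz]|nv] := pselect (vertex_of D v); first by exists z.
    by exists 0.
  by exists F.
exists F => t u v tD ut vt.
have hu := hF u (ex_intro2 _ _ t tD ut); have hv := hF v (ex_intro2 _ _ t tD vt).
by rewrite -(reach_uniq _ _ _ (reach_step _ _ _ _ tD ut vt hu) hv); lia.
Qed.

End Loop.
End Region.
End Lattice.

(* The antisymmetric form on pairs of adjacent vertices with value [- w i t] from
   [src i t] to [dst i t]; junk value 0 on non-adjacent vertices. *)
Definition edge_form (w : dir -> triangle -> int) (u v : vertex) : int :=
  let a := v.1 - u.1 in let b := v.2 - u.2 in
  if (a == 0) && (b == 1) then - w D0 (true, u)
  else if (a == 0) && (b == -1) then w D0 (true, v)
  else if (a == 1) && (b == -1) then - w D1 (true, (u.1, v.2))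
  else if (a == -1) && (b == 1) then w D1 (true, (v.1, u.2))
  else if (a == -1) && (b == 0) then - w D2 (true, v)
  else if (a == 1) && (b == 0) then w D2 (true, u)
  else 0.

(** * Primitives of closed forms on the region and on the plane *)

Section EdgeForm.
Variable w : dir -> triangle -> int.
Hypothesis w_nb : forall i t, w i (nb i t) = w i t.

Lemma edge_form_refl u : edge_form w u u = 0.
Proof. by rewrite /edge_form !subrr. Qed.

Lemma edge_form_edge i t :
  edge_form w (src i t) (dst i t) = - w i t /\ edge_form w (dst i t) (src i t) = w i t.
Proof.
have black j (c : vertex) :
    edge_form w (src j (true, c)) (dst j (true, c)) = - w j (true, c) /\
    edge_form w (dst j (true, c)) (src j (true, c)) = w j (true, c).
  case: c => a b; have d1 (z : int) : z - (z + 1) = -1 by ring.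
  by case: j; rewrite /edge_form /= ?d1 ?[in _ + 1 - _]addrC ?addKr ?subrr.
case: t => -[] c; first exact: black.
have := black i (nb i (false, c)).2.
have -> : (true, (nb i (false, c)).2) = nb i (false, c) by case: i c => -[] [].
by rewrite src_nb dst_nb w_nb.
Qed.

Lemma edge_form_triangle t u v x :
  w D0 t + w D1 t + w D2 t = 0 ->
  u \in vertices t -> v \in vertices t -> x \in vertices t ->
  edge_form w u v + edge_form w v x = edge_form w u x.
Proof.
move=> w0 /vertex_src[i ->] /vertex_src[j ->] /vertex_src[k ->].
have [a0 b0] := edge_form_edge D0 t.
have [a1 b1] := edge_form_edge D1 t.
have [a2 b2] := edge_form_edge D2 t.
have [r0 r1 r2] := And3 (edge_form_refl (src D0 t)) (edge_form_refl (src D1 t))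
  (edge_form_refl (src D2 t)).
case: t => -[] [a b] in w0 a0 b0 a1 b1 a2 b2 r0 r1 r2 *; move: a0 b0 a1 b1 a2 b2 r0 r1 r2;
  by case: i j k => -[] [] /=; lia.
Qed.

End EdgeForm.

Lemma closed_form_exact (R : realType) (D : {fset triangle})
    (w : dir -> triangle -> int) :
  simply_connected (@carrier R D) ->
  (forall i t, w i (nb i t) = w i t) ->
  (forall t, t \in D -> w D0 t + w D1 t + w D2 t = 0) ->
  exists F : vertex -> int, forall t i, t \in D -> descent F i t = w i t.
Proof.
move=> sc w_nb wD.
have [F hF] := potential (fun t u v x tD => edge_form_triangle w_nb (wD t tD)) sc.
exists F => t i tD; have [_ <-] := edge_form_edge w_nb i t.
by rewrite (hF t) ?src_vertex ?dst_vertex.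
Qed.

(** The first compactly supported cohomology of the plane vanishes: integrating from infinity along
    rows gives a primitive, and closedness controls its variation across rows. *)
Lemma plane_form_exact (w : dir -> triangle -> int) (L : nat) :
  (forall i t, w i (nb i t) = w i t) ->
  (forall t, w D0 t + w D1 t + w D2 t = 0) ->
  (forall i t, w i t != 0 -> `|t.2.1| < L%:Z /\ `|t.2.2| < L%:Z) ->
  exists F : vertex -> int, (forall t i, descent F i t = w i t) /\
    forall v, F v != 0 -> `|v.1| < L%:Z /\ `|v.2| < L%:Z.
Proof.
move=> w_nb w0 supp.
have sw i c a b : L%:Z <= `|a| \/ L%:Z <= `|b| -> w i (c, (a, b)) = 0.
  by move=> h; apply/eqP; apply/negP => /negP /supp /= -[]; lia.
pose s a b n := \sum_(k < n) w D2 (true, (a + k%:Z, b)).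
have s_add a b n k : L%:Z <= a + n%:Z -> s a b (n + k)%N = s a b n.
  elim: k => [|k IHk] h; first by rewrite addn0.
  by rewrite addnS /s big_ord_recr /= -/(s _ _ _) IHk// sw ?addr0//; left; lia.
have s_eq a b n m : L%:Z <= a + n%:Z -> L%:Z <= a + m%:Z -> s a b n = s a b m.
  by move=> hn hm; rewrite -(s_add _ _ _ m hn) addnC s_add.
(* Integration along the row, from infinity in the direction [(1, 0)]. *)
pose F (v : vertex) := - s v.1 v.2 `|L%:Z - v.1|%N.
have FE a b n : L%:Z <= a + n%:Z -> F (a, b) = - s a b n.
  by move=> h; rewrite /F (s_eq _ _ _ n) //=; lia.
have F2 a b : F (a + 1, b) - F (a, b) = w D2 (true, (a, b)).
  pose n := `|L%:Z - a|%N.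
  rewrite (FE a b n.+1); last by rewrite /n; lia.
  rewrite (FE (a + 1) b n); last by rewrite /n; lia.
  rewrite /s big_ord_recl /= addr0 opprK addrCA -[RHS]addr0; congr (_ + _).
  rewrite addrC; apply/eqP; rewrite subr_eq0; apply/eqP; apply: eq_bigr => i _.
  by congr (w D2 (true, (_, _))); rewrite /bump /=; lia.
(* Subtracting the closedness relations of the two triangles of a parallelogram cancels their common
   [D1] edge. *)
have cell a b : w D2 (true, (a, b + 1)) - w D2 (true, (a, b)) =
    w D0 (true, (a, b)) - w D0 (true, (a + 1, b)).
  have := w0 (true, (a, b)); have := w0 (false, (a, b)).
  rewrite -(w_nb D0 (false, _)) -(w_nb D1 (false, _)) -(w_nb D2 (false, _)) /=.
  by lra.
have F0 a b : F (a, b) - F (a, b + 1) = w D0 (true, (a, b)).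
  pose n := `|L%:Z - a|%N; have hn : L%:Z <= a + n%:Z by rewrite /n; lia.
  rewrite (FE a b n)// (FE a (b + 1) n)// opprK addrC -sumrB.
  have tele m : \sum_(k < m) (w D2 (true, (a + k%:Z, b + 1)) - w D2 (true, (a + k%:Z, b)))
      = w D0 (true, (a, b)) - w D0 (true, (a + m%:Z, b)).
    elim: m => [|m IHm]; first by rewrite big_ord0 addr0 subrr.
    rewrite big_ord_recr /= IHm cell.
    have -> : a + m.+1%:Z = a + m%:Z + 1 by lia.
    by lra.
  by rewrite tele [w D0 (true, (a + _, b))]sw ?subr0//; left; lia.
have Fblack c i : descent F i (true, c) = w i (true, c).
  case: c => a b; have h0 : descent F D0 (true, (a, b)) = w D0 (true, (a, b)) := F0 a b.
  have h2 : descent F D2 (true, (a, b)) = w D2 (true, (a, b)) := F2 a b.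
  case: i => //; have := w0 (true, (a, b)); have := descent_sum F (true, (a, b)).
  by rewrite h0 h2; lra.
exists F; split.
  move=> -[[] c] i; first exact: Fblack.
  rewrite -w_nb -descent_nb.
  have -> : nb i (false, c) = (true, (nb i (false, c)).2) by case: i c => -[] [].
  exact: Fblack.
have Fb a b : L%:Z <= `|b| -> F (a, b) = 0.
  by move=> hb; rewrite /F /s big1 ?oppr0// => i _; apply: sw; right.
(* In such a column the [D0] increments vanish, so [F] can be evaluated in a row beyond the
   support. *)
have Fa a b : L%:Z <= `|a| -> F (a, b) = 0.
  move=> ha; have up n : F (a, b) = F (a, b + n%:Z).
    elim: n => [|n IHn]; first by rewrite addr0.
    have := F0 a (b + n%:Z); rewrite sw; last by left.
    have -> : b + n%:Z + 1 = b + n.+1%:Z by lia.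
    by lra.
  by rewrite (up (`|b| + L)%N) Fb//; lia.
move=> [a b] /= h; split; rewrite ltNge; apply/negP => h'; move: h.
  by rewrite Fa ?eqxx.
by rewrite Fb ?eqxx.
Qed.

(** * The boundary *)

Definition orientation (t : triangle) : int := if t.1 then 1 else -1.

Lemma orientation_nb i t : orientation (nb i t) = - orientation t.
Proof. by rewrite /orientation nb_color; case: t.1. Qed.

(** A discrete Stokes formula: the involution [nb i] pairs the terms across inner edges with
    opposite signs, and the unpaired terms vanish. *)
Lemma sum_nb_eq0 (i : dir) (U : seq triangle) (f : triangle -> int) : uniq U ->
  (forall t, f (nb i t) = - f t) ->
  (forall t, t \in U -> nb i t \notin U -> f t = 0) ->
  \sum_(t <- U) f t = 0.
Proof.
move=> uU fnb fU; rewrite (bigID (fun t => nb i t \in U)) /=.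
rewrite [X in _ + X]big_seq_cond [X in _ + X]big1 ?addr0; last first.
  by move=> t /andP[tU nU]; exact: fU.
rewrite -big_filter; set V := [seq t <- U | nb i t \in U].
have VV : perm_eq (map (nb i) V) V.
  apply: uniq_perm; rewrite ?filter_uniq//.
    by rewrite map_inj_uniq ?filter_uniq//; exact: inv_inj (nbK i).
  move=> t; rewrite -[t in LHS](nbK i) mem_map; last exact: inv_inj (nbK i).
  by rewrite !mem_filter nbK andbC.
have : \sum_(t <- V) f t = - \sum_(t <- V) f t.
  rewrite -[in LHS](perm_big _ VV) big_map -sumrN.
  by apply: eq_bigr => t _; rewrite fnb.
by move: (\sum_(t <- V) f t) => S; lra.
Qed.

(* The 1-form counting the crossings with the ray leaving [t0] along its lattice
   row in the direction [(1, 0)]; it is closed except at [t0]. *)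
Definition ray (t0 : triangle) (i : dir) (t : triangle) : int :=
  let p := 2 * t0.2.1 + (if t0.1 then 0 else 1) in
  match i with
  | D0 => if (t.2.2 == t0.2.2) && (p < 2 * t.2.1 + (if t.1 then 0 else 2)) then 1 else 0
  | D1 => if (t.2.2 == t0.2.2) && (p < 2 * t.2.1 + 1) then -1 else 0
  | D2 => 0
  end.

Lemma ray_nb t0 i t : ray t0 i (nb i t) = ray t0 i t.
Proof.
case: t0 t i => c0 [a0 b0] [[] [a b]] [] //=; rewrite /ray /=;
by congr (if (_ && (_ < _)) then _ else _); ring.
Qed.

(** Number the triangles of a row from left to right, [2 * a] for black and [2 * a + 1] for white.
    Those after [t0] are entered and left by the ray, with cancelling contributions, while [t0] is
    only left. *)
Lemma ray_sum t0 t : ray t0 D0 t + ray t0 D1 t + ray t0 D2 t =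
  if t == t0 then - orientation t0 else 0.
Proof.
case: t0 t => c0 [a0 b0] [c [a b]]; rewrite /ray /orientation !xpair_eqE /= addr0.
by case: (b =P b0) => _; case: (a =P a0) => ?; case: c0 c => -[];
  rewrite ?andbF ?andbT /=; do ?case: ifP; lia.
Qed.

Section Boundary.
Variables (R : realType) (D : {fset triangle}).
Hypothesis D_sc : simply_connected (@carrier R D).

Lemma descent_const (F : vertex -> int) t u v :
  (forall i, descent F i t = 0) -> u \in vertices t -> v \in vertices t -> F u = F v.
Proof.
move=> F0; have := (F0 D0, F0 D1, F0 D2); rewrite /descent.
case: t {F0} => -[] [a b] /= [[h0 h1] h2]; rewrite !inE.
  by move=> /or3P[] /eqP -> /or3P[] /eqP ->; lra.
by move=> /or3P[] /eqP -> /or3P[] /eqP ->; lra.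
Qed.

Lemma vertex_const (F : vertex -> int) u v :
  (forall t i, t \in D -> descent F i t = 0) ->
  vertex_of D u -> vertex_of D v -> F u = F v.
Proof.
move=> F0 uD vD; have [_ pc _] := D_sc.
apply: (@vertex_ind R D (fun x => F u = F x) u v pc _ uD vD erefl).
by move=> t x y tD xt yt ->; apply: descent_const xt yt => i; exact: F0.
Qed.

Lemma bounded_region : exists L : nat, forall t, t \in D -> `|t.2.1| < L%:Z /\ `|t.2.2| < L%:Z.
Proof.
exists (\max_(t <- D) (`|t.2.1| + `|t.2.2|)%N).+1 => t tD.
have := leq_bigmax_seq (r := enum_fset D) (P := xpredT)
  (F := fun t : triangle => (`|t.2.1| + `|t.2.2|)%N) t tD isT.
by move: (\max_(_ <- _) _)%N => m /=; lia.
Qed.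

(** [F] is constant on each triangle outside [D]. If it is nonzero on [t0], the outside triangles
    where it is nonzero form a finite set [U], a hole whose border edges all lie along [D]. The ray
    from [t0] then gives a form closed on [D] that cannot be exact there. *)
Lemma outside_form_eq0 (F : vertex -> int) (L : nat) t0 :
  (forall v, F v != 0 -> `|v.1| < L%:Z /\ `|v.2| < L%:Z) ->
  (forall t i, t \notin D -> descent F i t = 0) ->
  t0 \notin D -> F (src D0 t0) = 0.
Proof.
move=> Fsupp FD t0D; apply/eqP; apply/negP => /negP Ft0.
(* [src D0] shifts the corner of a white triangle by 1, so corners with a coordinate of absolute
   value [L] may occur. *)
pose ints := [seq k%:Z - L.+1%:Z | k <- iota 0 (L.+1 + L.+1)].
have mem_ints (z : int) : `|z| <= L%:Z -> z \in ints.
  move=> zL; apply/mapP; exists (absz (z + L.+1%:Z)); rewrite ?mem_iota; lia.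
pose box := allpairs (@pair bool (int * int)) [:: true; false] (allpairs (@pair int int) ints ints).
pose U := undup [seq t <- box | (t \notin D) && (F (src D0 t) != 0)].
have uU : uniq U by exact: undup_uniq.
have memU t : (t \in U) = (t \notin D) && (F (src D0 t) != 0).
  rewrite mem_undup mem_filter andb_idr// => /andP[tD Ft].
  have [] := Fsupp _ Ft; case: t {tD Ft} => c [a b] h1 h2.
  apply/allpairsP; exists (c, (a, b)); split => //; first by case: c {h1 h2}.
  apply/allpairsP; exists (a, b); split => //=; apply: mem_ints.
    by case: c h1 {h2} => /=; lia.
  by case: c h2 {h1} => /=; lia.
have ray_closed t : t \in D -> ray t0 D0 t + ray t0 D1 t + ray t0 D2 t = 0.
  by move=> tD; rewrite ray_sum; case: eqP => // e; rewrite -e tD in t0D.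
have [f hf] := closed_form_exact D_sc (ray_nb t0) ray_closed.
(* The form [ray t0 - d f] vanishes on the edges of [D], hence on all edges
   between [U] and its complement: its total circulation around [U] is 0, but
   only [t0] contributes to it. *)
pose gamma i t := orientation t * (ray t0 i t - descent f i t).
have gamma0 i : \sum_(t <- U) gamma i t = 0.
  apply: (@sum_nb_eq0 i) => //.
    by move=> t; rewrite /gamma orientation_nb ray_nb descent_nb mulNr.
  move=> t; rewrite !memU => /andP[tD Ft]; rewrite negb_and !negbK => /orP[nD|/eqP Fn].
    by rewrite /gamma -ray_nb -descent_nb hf// subrr mulr0.
  have [nD|nD] := boolP (nb i t \in D).
    by rewrite /gamma -ray_nb -descent_nb hf// subrr mulr0.
  have e1 : F (src D0 t) = F (src i t).
    by apply: (@descent_const F t); rewrite ?src_vertex// => j; exact: FD.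
  have e2 : F (src D0 (nb i t)) = F (src i t).
    apply: (@descent_const F (nb i t)) (src_vertex _ _) _; first by move=> j; exact: FD.
    by rewrite -(src_nb i t) src_vertex.
  by move: Ft; rewrite e1 -e2 Fn eqxx.
have : \sum_(t <- U) (gamma D0 t + gamma D1 t + gamma D2 t) = 0.
  by rewrite !big_split /= !gamma0.
rewrite (eq_bigr (fun t => if t == t0 then -1 else 0)); last first.
  move=> t _; rewrite /gamma -!mulrDr.
  have := ray_sum t0 t; have := descent_sum f t => s1 s2.
  have -> : ray t0 D0 t - descent f D0 t + (ray t0 D1 t - descent f D1 t) +
    (ray t0 D2 t - descent f D2 t) = ray t0 D0 t + ray t0 D1 t + ray t0 D2 t by lra.
  rewrite s2; case: eqP => [->|_]; rewrite ?mulr0//.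
  by rewrite /orientation; case: t0.1.
rewrite (bigD1_seq t0) ?memU ?t0D//= eqxx big1//.
by move=> t /negbTE ->.
Qed.

(** The differential of [g] extends by 0 to a closed form on the plane. Its compactly supported
    primitive [F] vanishes on the triangles outside [D], and [g - F] is constant on [D]. *)
Lemma boundary_const (g : vertex -> int) u v :
  (forall t i, t \in D -> nb i t \notin D -> descent g i t = 0) ->
  boundary_vertex D u -> boundary_vertex D v -> g u = g v.
Proof.
move=> gb [uD [s sD us]] [vD [s' sD' vs']].
pose w i t := if t \in D then descent g i t else 0.
have w_nb i t : w i (nb i t) = w i t.
  rewrite /w; case: ifPn => tD; case: ifPn => nD //; first by rewrite descent_nb.
    by rewrite gb// nbK.
  by rewrite gb.
have w0 t : w D0 t + w D1 t + w D2 t = 0.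
  by rewrite /w; case: ifP => // _; exact: descent_sum.
have [L hL] := bounded_region.
have supp i t : w i t != 0 -> `|t.2.1| < L%:Z /\ `|t.2.2| < L%:Z.
  by rewrite /w; case: ifP => [/hL//|]; rewrite eqxx.
have [F [hF Fsupp]] := plane_form_exact w_nb w0 supp.
have FD t i : t \notin D -> descent F i t = 0.
  by move=> tD; rewrite hF /w (negbTE tD).
have Fout t x : t \notin D -> x \in vertices t -> F x = 0.
  move=> tD xt; rewrite -(outside_form_eq0 Fsupp FD tD).
  by apply: descent_const xt (src_vertex D0 t) => i; exact: FD.
have : g u - F u = g v - F v.
  apply: (@vertex_const (fun x => g x - F x)) => // t i tD.
  by have := hF t i; rewrite /w tD /descent; lra.
by rewrite (Fout s)// (Fout s')// !subr0.
Qed.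

End Boundary.

(** * Tilings and height functions *)

Lemma nb_inj t : injective (nb^~ t).
Proof.
case: t => -[] [a b] [] [] //= /eqP; rewrite !xpair_eqE; lia.
Qed.

Lemma is_edge_src i t : is_edge t (src i t) (dst i t).
Proof.
rewrite /is_edge src_vertex dst_vertex /=; case: i t => -[[] [a b]] /=;
by rewrite !xpair_eqE; lia.
Qed.

Lemma is_edgeC t x y : is_edge t x y = is_edge t y x.
Proof. by rewrite /is_edge andbCA eq_sym. Qed.

Lemma is_edge_dir t x y : is_edge t x y ->
  exists i, (x = src i t /\ y = dst i t) \/ (x = dst i t /\ y = src i t).
Proof.
move=> /and3P[/vertex_src[i ->] /vertex_src[j ->]].
case: t => -[] [a b]; case: i j => -[]; rewrite ?eqxx //= => _;
  first [by exists D0; (left + right) | by exists D1; (left + right)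
        | by exists D2; (left + right)].
Qed.

Lemma edge_triangle i s t : is_edge s (src i t) (dst i t) -> s = t \/ s = nb i t.
Proof.
move=> /and3P[us vs _].
suff : (s == t) || (s == nb i t) by move/orP => [] /eqP; [left|right].
case: s t i us vs => -[] [a b] [[] [c d]] [];
by rewrite /= !inE !xpair_eqE; lia.
Qed.

Lemma next_white i t : white t -> next (vertices t) (src i t) = dst i t.
Proof.
case: t => -[] [a b] // _.
have e1 (z : int) : (z == z + 1) = false by lia.
have e2 (z : int) : (z + 1 == z) = false by lia.
by case: i; rewrite /= !xpair_eqE ?eqxx ?e1 ?e2 ?andbF.
Qed.

Lemma white_on_leftP x y :
  white_on_left x y <-> exists i t, x = src i t /\ y = dst i t.
Proof.
split=> [[t [wt /vertex_src[i ->] <-]]|[i [t [-> ->]]]].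
  by exists i, t; rewrite next_white.
have [wt|bt] := boolP (white t).
  by exists t; rewrite src_vertex next_white.
exists (nb i t); rewrite -(src_nb i t) -(dst_nb i t).
have wn : white (nb i t) by rewrite /white nb_color.
by rewrite src_vertex next_white.
Qed.

Lemma adjacentP s t : adjacent s t <-> exists i, t = nb i s.
Proof.
split=> [[st [x [y [es et]]]]|[i ->]]; last first.
  split; first exact: nb_neq.
  exists (src i s), (dst i s); split; first exact: is_edge_src.
  by rewrite -(src_nb i s) -(dst_nb i s) is_edge_src.
have [i sti] : exists i, is_edge t (src i s) (dst i s).
  by have [i [[ex ey]|[ex ey]]] := is_edge_dir es; exists i; rewrite -ex -ey // is_edgeC.
by have [e|e] := edge_triangle sti; [rewrite e eqxx in st|exists i].
Qed.

(** The local description of heights, free of any tiling, so that it can be checked on minima and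
    maxima. *)
Definition admissible (E : {fset triangle}) (h : vertex -> int) : Prop :=
  forall t i, t \in E -> (descent h i t = 1 \/ descent h i t = -2) /\
    (nb i t \notin E -> descent h i t = 1).

Section Tiling.
Variables (E : {fset triangle}) (T : {fset {fset triangle}}).
Hypothesis ET : is_tiling E T.

Lemma tiling_partner t : t \in E -> exists i, [/\ nb i t \in E,
  [fset t; nb i t]%fset \in T & forall j, [fset t; nb j t]%fset \in T -> j = i].
Proof.
move=> tE; have [hT hE] := ET.
have [L [[LT tL] Lu]] := hE t tE.
have [[s [s' [/adjacentP[i ->] eL]]] LE] := hT L LT.
have {}eL : L = [fset t; nb i t]%fset.
  move: tL; rewrite eL !inE => /orP[] /eqP -> //.
  by rewrite nbK fsetUC.
exists i; split.
- by apply: (fsubsetP LE); rewrite eL !inE eqxx orbT.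
- by rewrite -eL.
- move=> j jT; apply: (@nb_inj t); have := Lu _ (conj jT (fset21 _ _)).
  rewrite eL => e; have : nb j t \in [fset t; nb i t]%fset by rewrite e fset22.
  by rewrite !inE eq_sym (negbTE (nb_neq j t)) => /eqP.
Qed.

Lemma height_descent h t i : is_height_function T h -> t \in E ->
  [fset t; nb i t]%fset \notin T -> descent h i t = 1.
Proof.
move=> hh tE iT; have [j [jE jT _]] := tiling_partner tE.
apply: hh; last by apply/white_on_leftP; exists i, t.
exists [fset t; nb j t]%fset => //; exists t; split.
  by rewrite fset21 is_edge_src.
move=> s [sL /edge_triangle[//|e]]; move: sL iT; rewrite e !inE.
rewrite eq_sym (negbTE (nb_neq i t)) /= => /eqP /nb_inj ->.
by rewrite jT.
Qed.

Lemma height_functionP h : (forall t i, t \in E ->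
  [fset t; nb i t]%fset \notin T -> descent h i t = 1) -> is_height_function T h.
Proof.
have [hT hE] := ET.
move=> hd x y [L LT [t [[tL et] tu]]] /white_on_leftP[i [s [ex ey]]].
have [_ LE] := hT L LT.
have tE : t \in E by exact: (fsubsetP LE).
have {s ex ey} [ex ey] : x = src i t /\ y = dst i t.
  move: et; rewrite ex ey => /edge_triangle[] -> //.
  by rewrite src_nb dst_nb.
rewrite ex ey; apply: hd => //; apply/negP => iT.
have [L' [_ Lu]] := hE t tE.
have eL : L = [fset t; nb i t]%fset.
  by rewrite -(Lu L (conj LT tL)) -(Lu _ (conj iT (fset21 _ _))).
have eN : is_edge (nb i t) x y.
  by rewrite ex ey -(src_nb i t) -(dst_nb i t) is_edge_src.
have nL : nb i t \in L by rewrite eL fset22.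
by have := nb_neq i t; rewrite -(tu _ (conj nL eN)) eqxx.
Qed.

Lemma partner_descent h t i j : is_height_function T h -> t \in E ->
  [fset t; nb i t]%fset \in T ->
  (j = i -> descent h j t = -2) /\ (j <> i -> descent h j t = 1).
Proof.
move=> hh tE iT; have [i' [_ _ iu]] := tiling_partner tE.
have d1 l : l <> i -> descent h l t = 1.
  move=> li; apply: height_descent => //; apply/negP => /iu e.
  by apply: li; rewrite e (iu i iT).
split; last exact: d1.
have := descent_sum h t; move=> + ->.
case: i d1 {iT iu} => d1.
- by rewrite (d1 D1)// (d1 D2)// => {d1}; lra.
- by rewrite (d1 D0)// (d1 D2)// => {d1}; lra.
- by rewrite (d1 D0)// (d1 D1)// => {d1}; lra.
Qed.

Lemma tiling_admissible h : is_height_function T h -> admissible E h.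
Proof.
move=> hh t j tE; have [i [iE iT _]] := tiling_partner tE.
have [d1 d2] := partner_descent j hh tE iT.
have [ji|ji] : j = i \/ j <> i by case: (i) (j) => -[]; by [left|right].
  by split; [right; exact: d1|rewrite ji iE].
by split; [left|]; rewrite d2.
Qed.

Lemma height_descent_uniq h h' t i : is_height_function T h ->
  is_height_function T h' -> t \in E -> descent h i t = descent h' i t.
Proof.
move=> hh hh' tE; have [j [_ jT _]] := tiling_partner tE.
have [d1 d2] := partner_descent i hh tE jT.
have [d1' d2'] := partner_descent i hh' tE jT.
have [ji|ji] : i = j \/ i <> j by case: (i) (j) => -[]; by [left|right].
  by rewrite d1// d1'.
by rewrite d2// d2'.
Qed.

(** The prescribed drops are -2 across a lozenge and 1 elsewhere; they form a closed form because
    each triangle has exactly one edge inside its lozenge. *)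
Lemma height_function_exists (R : realType) :
  simply_connected (@carrier R E) -> exists h, is_height_function T h.
Proof.
move=> sc.
pose w i t : int := if [fset t; nb i t]%fset \in T then -2 else 1.
have [||F hF] := @closed_form_exact R E w sc.
- by move=> i t; rewrite /w nbK fsetUC.
- move=> t tE; have [i [_ iT iu]] := tiling_partner tE.
  have wE j : j <> i -> w j t = 1.
    by move=> ji; rewrite /w; case: ifP => // /iu.
  have wi : w i t = -2 by rewrite /w iT.
  case: i wi wE {iT iu} => -> wE.
  - by rewrite (wE D1)// (wE D2).
  - by rewrite (wE D0)// (wE D2).
  - by rewrite (wE D0)// (wE D1).
- exists F; apply: height_functionP => t i tE iT.
  by rewrite hF// /w (negbTE iT).
Qed.

End Tiling.

(** Each triangle is matched across its unique edge of drop -2. The neighbour sees the same edge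
    with the same drop, so the matching is symmetric. *)
Lemma admissible_tiling E h : admissible E h ->
  exists T, is_tiling E T /\ is_height_function T h.
Proof.
move=> hE.
(* On [E] the default [D2] is right, since the three drops sum to 0 and cannot all be 1. *)
pose mu t := if descent h D0 t == -2 then D0 else if descent h D1 t == -2 then D1 else D2.
have muE t : t \in E -> [/\ descent h (mu t) t = -2, nb (mu t) t \in E
    & forall i, descent h i t = -2 -> i = mu t].
  move=> tE; have [d0 _] := hE t D0 tE; have [d1 _] := hE t D1 tE.
  have [d2 _] := hE t D2 tE; have s := descent_sum h t.
  have mu2 : descent h (mu t) t = -2.
    by rewrite /mu; case: eqP => // n0; case: eqP => // n1; lra.
  split => //.
    apply/negP => /negP nE; have [_ /(_ nE)] := hE t (mu t) tE.
    by rewrite mu2.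
  by move: mu2; case: (mu t) => m2 [] // m2'; exfalso; lia.
have mu_nb t : t \in E -> mu (nb (mu t) t) = mu t.
  move=> tE; have [m2 mE _] := muE t tE; have [_ _ u] := muE _ mE.
  by symmetry; apply: u; rewrite descent_nb.
pose T := [fset [fset t; nb (mu t) t] | t in E]%fset.
have TP L : L \in T -> exists2 t, t \in E & L = [fset t; nb (mu t) t]%fset.
  by move=> /imfsetP[t tE ->]; exists t.
have ET : is_tiling E T.
  split.
    move=> L /TP[t tE ->]; split.
      by exists t, (nb (mu t) t); split=> //; apply/adjacentP; exists (mu t).
    by have [_ mE _] := muE t tE; apply/fsubsetP => s; rewrite !inE => /orP[] /eqP ->.
  move=> t tE; exists [fset t; nb (mu t) t]%fset; split.
    by split; [apply/imfsetP; exists t|rewrite fset21].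
  move=> L [/TP[s sE ->]]; rewrite !inE => /orP[] /eqP ->//.
  by rewrite mu_nb// nbK fsetUC.
exists T; split => //; apply: (height_functionP ET) => t i tE iT.
have [//|d2] := (hE t i tE).1.
have [_ _ /(_ i d2) e] := muE t tE.
by move: iT; rewrite e => /negP[]; apply/imfsetP; exists t.
Qed.

(** * Hexagons *)

Definition hex_within (x : vertex) (k : nat) (v : vertex) : bool :=
  [&& `|v.1 - x.1| <= k%:Z, `|v.2 - x.2| <= k%:Z
    & `|(v.1 - x.1) + (v.2 - x.2)| <= k%:Z].

Lemma in_hexagonE x k t : in_hexagon x k t = all (hex_within x k) (vertices t).
Proof. by []. Qed.

Lemma in_hexagon_within x k t v :
  in_hexagon x k t -> v \in vertices t -> hex_within x k v.
Proof. by rewrite in_hexagonE => /allP; apply. Qed.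

(* The largest and the smallest height functions of the whole lattice vanishing
   at [x]. *)
Definition cone_max (x v : vertex) : int :=
  let p := v.1 - x.1 in let q := v.2 - x.2 in
  p - q + 3 * Num.max 0 (Num.max (- p) q).

Definition cone_min (x v : vertex) : int :=
  let p := v.1 - x.1 in let q := v.2 - x.2 in
  p - q - 3 * Num.max 0 (Num.max p (- q)).

Lemma cone_max_center x : cone_max x x = 0.
Proof. by rewrite /cone_max; lia. Qed.

Lemma cone_min_center x : cone_min x x = 0.
Proof. by rewrite /cone_min; lia. Qed.

Lemma descent_cone_max x t i :
  descent (cone_max x) i t = 1 \/ descent (cone_max x) i t = -2.
Proof.
by rewrite /descent /cone_max; case: x t i => x y [[] [a b]] [] /=; lia.
Qed.

Lemma descent_cone_min x t i :
  descent (cone_min x) i t = 1 \/ descent (cone_min x) i t = -2.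
Proof.
by rewrite /descent /cone_min; case: x t i => x y [[] [a b]] [] /=; lia.
Qed.

(** No lozenge of the cone's tiling crosses the boundary of a hexagon centered at the apex, so this
    tiling can be cut there. *)
Lemma hexagon_side x k t i : ~~ in_hexagon x k t -> in_hexagon x k (nb i t) ->
  descent (cone_max x) i t = 1.
Proof.
rewrite !in_hexagonE /descent /cone_max.
by case: x t i => x y [[] [a b]] []; rewrite /= /hex_within /=; lia.
Qed.

(** The difference of the cones is three times the hexagonal distance to [x], because the numbers 0,
    [- p], [q] have spread equal to the largest of [|p|], [|q|], [|p + q|]. A vertex of the hexagon
    touching an outside triangle is at distance exactly [k]. *)
Lemma cone_sphere x k t v : ~~ in_hexagon x k t -> v \in vertices t ->
  hex_within x k v -> 3 * k%:Z + cone_min x v = cone_max x v.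
Proof.
rewrite in_hexagonE /cone_max /cone_min.
case: x t v => x y [[] [a b]] [c d]; rewrite /= /hex_within /= !inE !xpair_eqE;
by move=> + /or3P[] /andP[/eqP -> /eqP ->]; lia.
Qed.

Lemma in_hexagon_inner x k t : in_hexagon x k t ->
  exists k' v, [/\ k = k'.+1, v \in vertices t & hex_within x k' v].
Proof.
rewrite in_hexagonE; case: k => [|k] H.
  by exfalso; move: H; case: x t => x y [[] [a b]]; rewrite /= /hex_within /=; lia.
suff : has (hex_within x k) (vertices t) by move/hasP => [v vt hv]; exists k, v.
by move: H; case: x t => x y [[] [a b]]; rewrite /= /hex_within /=; lia.
Qed.

(** An edge leads back towards [x]; along it, outwards, [cone_max] rises and [cone_min] falls as
    much as an admissible function can. This drives the inductions on the distance to [x]. *)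
Lemma hex_radial x k v : hex_within x k.+1 v ->
  v = x \/ exists t i, in_hexagon x k.+1 t /\
   ([/\ v = src i t, hex_within x k (dst i t), descent (cone_max x) i t = 1
      & descent (cone_min x) i t = -2] \/
    [/\ v = dst i t, hex_within x k (src i t), descent (cone_max x) i t = -2
      & descent (cone_min x) i t = 1]).
Proof.
move=> hv; pose p := v.1 - x.1; pose q := v.2 - x.2.
have ev : v = (x.1 + p, x.2 + q).
  by rewrite /p /q !subrKC; case: (v).
move: p q ev hv => p q {v} ->.
case: x => x y; rewrite /hex_within /= => hv.
have [pq|] := boolP ((p == 0) && (q == 0)).
  by left; case/andP: pq => /eqP -> /eqP ->; rewrite !addr0.
rewrite negb_and => pq; right.
(* The six sectors around [x] in counterclockwise order; in each, one fixed edge direction leads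
   back towards [x]. *)
have [s1|s1] := boolP ((0 < p) && (0 <= q)).
  exists (true, (x + p - 1, y + q)), D2.
  rewrite in_hexagonE /hex_within /descent /cone_max /cone_min /= subrK.
  by split; [lia|left; split => //; lia].
have [s2|s2] := boolP ((0 < q) && (0 < p + q)).
  exists (true, (x + p, y + q - 1)), D0.
  rewrite in_hexagonE /hex_within /descent /cone_max /cone_min /= subrK.
  by split; [lia|right; split => //; lia].
have [s3|s3] := boolP ((p < 0) && (0 < q)).
  exists (true, (x + p, y + q - 1)), D1.
  rewrite in_hexagonE /hex_within /descent /cone_max /cone_min /= subrK.
  by split; [lia|left; split => //; lia].
have [s4|s4] := boolP ((p < 0) && (q <= 0)).
  exists (true, (x + p, y + q)), D2.
  rewrite in_hexagonE /hex_within /descent /cone_max /cone_min /=.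
  by split; [lia|right; split => //; lia].
have [s5|s5] := boolP ((q < 0) && (p + q < 0)).
  exists (true, (x + p, y + q)), D0.
  rewrite in_hexagonE /hex_within /descent /cone_max /cone_min /=.
  by split; [lia|left; split => //; lia].
exists (true, (x + p - 1, y + q)), D1.
rewrite in_hexagonE /hex_within /descent /cone_max /cone_min /= subrK.
by split; [lia|right; split => //; lia].
Qed.

Lemma hex_within0 x v : hex_within x 0 v -> v = x.
Proof.
case: x v => x y [a b]; rewrite /hex_within /= => h.
by apply/eqP; rewrite xpair_eqE; lia.
Qed.

Lemma hex_within_le x j k v : (j <= k)%N -> hex_within x j v -> hex_within x k v.
Proof. by rewrite /hex_within; lia. Qed.

Lemma in_hexagon_le x j k t : (j <= k)%N -> in_hexagon x j t -> in_hexagon x k t.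
Proof. by rewrite !in_hexagonE => jk; apply: sub_all => v; exact: hex_within_le. Qed.

Lemma hexagon_const (F : vertex -> int) x k v :
  (forall t i, in_hexagon x k t -> descent F i t = 0) ->
  hex_within x k v -> F v = F x.
Proof.
move=> F0.
suff H j : (j <= k)%N -> forall v, hex_within x j v -> F v = F x.
  by apply: H.
elim: j => [_ u /hex_within0 -> //|j IHj jk u /hex_radial[->//|[t [i [ht H]]]]].
have := F0 t i (in_hexagon_le jk ht); rewrite /descent.
by case: H => -[-> hw _ _]; rewrite (IHj (ltnW jk) _ hw); lra.
Qed.

(** * Heights modulo 3, bounds and boundary values *)

Section Heights.
Variables (R : realType) (D : {fset triangle}).
Hypothesis D_sc : simply_connected (@carrier R D).

Lemma vertex_mod3 (F : vertex -> int) u v :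
  (forall t i, t \in D -> exists z, descent F i t = 3 * z) ->
  vertex_of D u -> vertex_of D v -> exists z, F v - F u = 3 * z.
Proof.
move=> F0 uD vD; have [_ pc _] := D_sc.
apply: (@vertex_ind R D (fun y => exists z, F y - F u = 3 * z) u v pc _ uD vD); last first.
  by exists 0; rewrite subrr.
move=> t a b tD /vertex_src[i ->] /vertex_src[j ->] [z hz].
have [z0 h0] := F0 t D0 tD; have [z1 h1] := F0 t D1 tD; have [z2 h2] := F0 t D2 tD.
move: h0 h1 h2; rewrite /descent; case: t i j {tD} hz => -[] [c d] [] [] /= hz h0 h1 h2;
  first [by exists z; lra | by exists (z + z0); lra | by exists (z - z0); lra
        | by exists (z + z1); lra | by exists (z - z1); lra
        | by exists (z + z2); lra | by exists (z - z2); lra].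
Qed.
Lemma descent_shift h m i t : descent (fun v => h v + m) i t = descent h i t.
Proof. by rewrite /descent; lra. Qed.

Lemma admissible_shift E h m : admissible E h -> admissible E (fun v => h v + m).
Proof. by move=> hE t i tE; rewrite descent_shift; exact: hE. Qed.

(** The drops 1 and -2 agree modulo 3, so one value determines a height function modulo 3. *)
Lemma admissible_mod3 h1 h2 x0 x :
  (forall t i, t \in D -> descent h1 i t = 1 \/ descent h1 i t = -2) ->
  (forall t i, t \in D -> descent h2 i t = 1 \/ descent h2 i t = -2) ->
  vertex_of D x0 -> vertex_of D x -> h1 x0 = h2 x0 ->
  exists z, h1 x - h2 x = 3 * z.
Proof.
move=> a1 a2 x0D xD e.
have [||//|z] := @vertex_mod3 (fun v => h1 v - h2 v) x0 x; first last.
- by rewrite e subrr subr0 => h; exists z.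
- by [].
- move=> t i tD; have := a1 t i tD; have := a2 t i tD; rewrite /descent.
  move: (h1 (src i t)) (h1 (dst i t)) (h2 (src i t)) (h2 (dst i t)) => a b c d.
  by case=> e1 [] e2; [exists 0|exists (-1)|exists 1|exists 0]; lia.
Qed.

Lemma admissible_bounded x0 x : vertex_of D x0 -> vertex_of D x ->
  exists B : int, forall h, admissible D h -> `|h x - h x0| <= B.
Proof.
move=> x0D xD; have [_ pc _] := D_sc.
apply: (@vertex_ind R D (fun y => exists B : int, forall h,
  admissible D h -> `|h y - h x0| <= B) x0 x pc _ x0D xD); last first.
  by exists 0 => h _; rewrite subrr normr0.
(* Heights at two vertices of a triangle differ by at most 2, so 4 is ample. *)
move=> t a b tD /vertex_src[i ->] /vertex_src[j ->] [B hB]; exists (B + 4) => h hh.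
have {hB} := hB h hh.
have [d0 _] := hh t D0 tD; have [d1 _] := hh t D1 tD; have [d2 _] := hh t D2 tD.
move: d0 d1 d2; rewrite /descent; case: t {tD} => -[] [p q]; case: i j => -[] /=;
move: (h x0) (h (p, q)) (h (p + 1, q)) (h (p, q + 1)) (h (p + 1, q + 1)) => a0 a1 a2 a3 a4; lia.
Qed.

Lemma boundary_agree h1 h2 x0 v : admissible D h1 -> admissible D h2 ->
  h1 x0 = h2 x0 -> boundary_vertex D x0 -> boundary_vertex D v -> h1 v = h2 v.
Proof.
move=> a1 a2 e bx0 bv.
have : h1 v - h2 v = h1 x0 - h2 x0.
  apply: (boundary_const (g := fun u => h1 u - h2 u) D_sc) => // t i tD nD.
  have := (a1 t i tD).2 nD; have := (a2 t i tD).2 nD; rewrite /descent.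
  by move=> /= e1 e2; rewrite -e1 in e2; lra.
by rewrite e subrr => /eqP; rewrite subr_eq0 => /eqP.
Qed.

Lemma interior_triangle v t : vertex_of D v -> ~ boundary_vertex D v ->
  v \in vertices t -> t \in D.
Proof.
by move=> vD nb vt; apply/negPn/negP => tD; apply: nb; split => //; exists t.
Qed.

(** * From a height gap to a removable hexagon *)

Section LargeHexagon.
Variables (h1 h2 : vertex -> int) (x : vertex) (k : nat).
Hypotheses (a1 : admissible D h1) (a2 : admissible D h2) (xD : vertex_of D x).
Hypothesis agree : forall v, boundary_vertex D v -> h1 v = h2 v.
Hypothesis gap : h1 x - h2 x = 3 * k%:Z.

(** Induction outwards from [x]. The gap loses at most 3 per step, so it is positive before distance
    [k]; by [agree] such vertices are interior, hence the triangles around them lie in [D] and the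
    next step is possible. The cone bounds follow from [hex_radial]. *)
Lemma hexagon_heights j v : (j <= k)%N -> hex_within x j v ->
  [/\ vertex_of D v, 3 * (k%:Z - j%:Z) <= h1 v - h2 v,
      h2 v <= h2 x + cone_max x v & h1 x + cone_min x v <= h1 v].
Proof.
have center j' : [/\ vertex_of D x, 3 * (k%:Z - j'%:Z) <= h1 x - h2 x,
    h2 x <= h2 x + cone_max x x & h1 x + cone_min x x <= h1 x].
  by rewrite cone_max_center cone_min_center gap; split => //; lia.
elim: j v => [|j IHj] v jk; first by move/hex_within0 ->; exact: center.
move=> /hex_radial[->|[t [i [_ H]]]]; first exact: center.
have step u : u \in vertices t -> hex_within x j u -> t \in D /\
  [/\ 3 * (k%:Z - j%:Z) <= h1 u - h2 u,
      h2 u <= h2 x + cone_max x u & h1 x + cone_min x u <= h1 u].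
  move=> ut hu; have [uD g c1 c2] := IHj u (ltnW jk) hu; split => //.
  by apply: interior_triangle uD _ ut => /agree e; lia.
case: H => -[-> hu d1 d2].
- have [tD [g c1 c2]] := step _ (dst_vertex i t) hu.
  have [b1 _] := a1 i tD; have [b2 _] := a2 i tD.
  split; first by exists t => //; exact: src_vertex.
  + move: b1 b2; rewrite /descent; lia.
  + move: b2 d1; rewrite /descent; lia.
  + move: b1 d2; rewrite /descent; lia.
- have [tD [g c1 c2]] := step _ (src_vertex i t) hu.
  have [b1 _] := a1 i tD; have [b2 _] := a2 i tD.
  split; first by exists t => //; exact: dst_vertex.
  + move: b1 b2; rewrite /descent; lia.
  + move: b2 d1; rewrite /descent; lia.
  + move: b1 d2; rewrite /descent; lia.
Qed.

Lemma hexagon_inside t : in_hexagon x k t -> t \in D.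
Proof.
move=> /in_hexagon_inner[k' [v [kE vt hv]]].
have kk : (k' <= k)%N by rewrite kE.
have [vD g _ _] := hexagon_heights kk hv.
apply: interior_triangle vD _ vt => /agree e; lia.
Qed.

Lemma large_hexagon_removable : removable_hexagons D x k.
Proof.
split; first exact: hexagon_inside.
pose S := [fset t in D | ~~ in_hexagon x k t]%fset.
have memS t : (t \in S) = (t \in D) && ~~ in_hexagon x k t by rewrite !inE.
(* The median of [h1], [h2] and the cone. *)
pose f v := Num.max (Num.min (h1 v) (h2 v))
  (Num.min (Num.max (h1 v) (h2 v)) (h2 x + cone_max x v)).
have fb v : boundary_vertex D v -> f v = h1 v.
  by move=> /agree e; rewrite /f -e; lia.
have vD t v : t \in D -> v \in vertices t -> vertex_of D v by move=> tD vt; exists t.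
(* On the boundary of the hexagon the cone lies between [h2] and [h1], as [h1] is at least
   [h2 x + 3k + cone_min], so it is the median. *)
have fside t v : ~~ in_hexagon x k t -> v \in vertices t -> hex_within x k v ->
    f v = h2 x + cone_max x v.
  move=> tH vt hv; have [_ _ c1 c2] := hexagon_heights (leqnn k) hv.
  by have := cone_sphere tH vt hv; rewrite /f; lia.
suff fS : admissible S f by have [T [ST _]] := admissible_tiling fS; exists T.
move=> t i; rewrite memS => /andP[tD tH]; split; last first.
  rewrite memS negb_and negbK => /orP[nD|nH].
    have bs : boundary_vertex D (src i t).
      split; first exact: vD tD (src_vertex i t).
      by exists (nb i t); rewrite // -(src_nb i t) src_vertex.
    have bd : boundary_vertex D (dst i t).
      split; first exact: vD tD (dst_vertex i t).
      by exists (nb i t); rewrite // -(dst_nb i t) dst_vertex.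
    by rewrite /descent !fb//; exact: (a1 i tD).2.
  have ws : hex_within x k (src i t).
    by apply: in_hexagon_within nH _; rewrite -(src_nb i t) src_vertex.
  have wd : hex_within x k (dst i t).
    by apply: in_hexagon_within nH _; rewrite -(dst_nb i t) dst_vertex.
  rewrite /descent !(fside t) ?src_vertex ?dst_vertex//.
  by have := hexagon_side tH nH; rewrite /descent; lra.
have mod3 (h h' : vertex -> int) v : h x = h' x ->
    (forall t i, t \in D -> descent h i t = 1 \/ descent h i t = -2) ->
    (forall t i, t \in D -> descent h' i t = 1 \/ descent h' i t = -2) ->
    vertex_of D v -> exists z, h v - h' v = 3 * z.
  by move=> e ah ah' vv; exact: admissible_mod3 ah ah' xD vv e.
(* Lowering [h1] by [3k] makes the two values at [x] equal without changing residues modulo 3. *)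
have h12 v : vertex_of D v -> exists z, h1 v - h2 v = 3 * z.
  move=> vv; have [|||//|z hz] := mod3 (fun v => h1 v + - (3 * k%:Z)) h2 v.
  - by lia.
  - by move=> t' j t'D; rewrite descent_shift; exact: (a1 j t'D).1.
  - by move=> t' j t'D; exact: (a2 j t'D).1.
  - by exists (z + k%:Z); lia.
have hc2 v : vertex_of D v -> exists z, h2 x + cone_max x v - h2 v = 3 * z.
  move=> vv; have [|||//|z hz] := mod3 (fun v => cone_max x v + h2 x) h2 v.
  - by rewrite cone_max_center add0r.
  - by move=> t' j _; rewrite descent_shift; exact: descent_cone_max.
  - by move=> t' j t'D; exact: (a2 j t'D).1.
  - by exists z; lia.
have [z1 hz1] := h12 _ (vD _ _ tD (src_vertex i t)).
have [z2 hz2] := hc2 _ (vD _ _ tD (src_vertex i t)).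
have [e1 _] := a1 i tD; have [e2 _] := a2 i tD; have e3 := descent_cone_max x t i.
move: e1 e2 e3 hz1 hz2; rewrite /descent /f.
move: (h1 (src i t)) (h1 (dst i t)) (h2 (src i t)) (h2 (dst i t)) => b1 b2 b3 b4.
move: (cone_max x (src i t)) (cone_max x (dst i t)) (h2 x) => b5 b6 b7.
(* The difference of the two functions is a multiple of 3 and changes by at most 3 along the edge,
   so it never changes sign strictly: one of them is extremal at both ends. *)
have minP p q p' q' (z : int) : p - p' = 1 \/ p - p' = -2 -> q - q' = 1 \/ q - q' = -2 ->
    p - q = 3 * z -> Num.min p q - Num.min p' q' = 1 \/ Num.min p q - Num.min p' q' = -2.
  lia.
have maxP p q p' q' (z : int) : p - p' = 1 \/ p - p' = -2 -> q - q' = 1 \/ q - q' = -2 ->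
    p - q = 3 * z -> Num.max p q - Num.max p' q' = 1 \/ Num.max p q - Num.max p' q' = -2.
  lia.
move=> e1 e2 e3 hz1 hz2.
have e3' : (b7 + b5) - (b7 + b6) = 1 \/ (b7 + b5) - (b7 + b6) = -2 by lia.
have eM := maxP _ _ _ _ _ e1 e2 hz1.
have em := minP _ _ _ _ _ e1 e2 hz1.
have [y1 hy1] : exists y, Num.max b1 b3 - (b7 + b5) = 3 * y.
  by have [h|h] := lerP b1 b3; [exists (- z2)|exists (z1 - z2)]; lia.
have eM' := minP _ _ _ _ _ eM e3' hy1.
have [y2 hy2] : exists y, Num.min b1 b3 - Num.min (Num.max b1 b3) (b7 + b5) = 3 * y.
  have [h|h] := lerP b1 b3; have [h'|h'] := lerP (Num.max b1 b3) (b7 + b5);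
  first [by exists z1; lia | by exists (- z1); lia | by exists 0; lia
   | by exists (z1 - z2); lia | by exists (- z2); lia].
exact: maxP em eM' hy2.
Qed.

End LargeHexagon.

(** The hexagon is tiled with height [cone_max], the rest by the given tiling. Exchanging [cone_max]
    for [3k + cone_min] on the hexagon keeps the values on its boundary by [cone_sphere] and raises
    [x] by [3k]. *)
Lemma removable_hexagon_heights x0 x k : boundary_vertex D x0 -> vertex_of D x ->
  removable_hexagons D x k -> exists h1 h2, [/\ admissible D h1, admissible D h2,
    h1 x0 = 0, h2 x0 = 0 & h1 x - h2 x = 3 * k%:Z].
Proof.
move=> [x0D [s0 s0D x0s]] xD [HD [T' ET']].
pose S := [fset t in D | in_hexagon x k t]%fset.
have memS t : (t \in S) = in_hexagon x k t.
  by rewrite !inE andb_idl// => /HD.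
have [TS [ES hS]] : exists T, is_tiling S T /\ is_height_function T (cone_max x).
  apply: admissible_tiling => t i tS; split; first exact: descent_cone_max.
  move=> nS; rewrite -descent_nb; apply: (@hexagon_side x k); rewrite -memS //.
  by rewrite nbK.
pose T := (T' `|` TS)%fset.
have memE t : (t \in [fset t in D | ~~ in_hexagon x k t]%fset) = (t \in D) && ~~ in_hexagon x k t.
  by rewrite !inE.
have DT : is_tiling D T.
  have [l' u'] := ET'; have [l u] := ES.
  have sub1 L t : L \in T' -> t \in L -> t \in D /\ ~~ in_hexagon x k t.
    by move=> LT tL; have [_ /fsubsetP/(_ t tL)] := l' L LT; rewrite memE => /andP.
  have sub2 L t : L \in TS -> t \in L -> in_hexagon x k t.
    by move=> LT tL; have [_ /fsubsetP/(_ t tL)] := l L LT; rewrite memS.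
  split.
    move=> L; rewrite inE => /orP[LT|LT]; split.
    - by have [] := l' L LT.
    - by apply/fsubsetP => t tL; have [] := sub1 L t LT tL.
    - by have [] := l L LT.
    - by apply/fsubsetP => t tL; apply: HD; exact: sub2 LT tL.
  move=> t tD; have [tH|tH] := boolP (in_hexagon x k t).
    have [|L [[LT tL] Lu]] := u t; first by rewrite memS.
    exists L; split; first by rewrite inE LT orbT.
    move=> L1 [+ tL1]; rewrite inE => /orP[L1T|L1T]; last exact: Lu.
    by have [_] := sub1 _ _ L1T tL1; rewrite tH.
  have [|L [[LT tL] Lu]] := u' t; first by rewrite memE tD.
  exists L; split; first by rewrite inE LT.
  move=> L1 [+ tL1]; rewrite inE => /orP[L1T|L1T]; first exact: Lu.
  by have := sub2 _ _ L1T tL1; rewrite (negbTE tH).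
have [h' hh'] := height_function_exists DT D_sc.
pose h v := h' v + - h' x0.
have hh : is_height_function T h.
  by move=> a b eab wab; have := hh' a b eab wab; rewrite /h; lra.
have ah := tiling_admissible DT hh.
have hx0 : h x0 = 0 by rewrite /h subrr.
have hhS : is_height_function TS h.
  move=> a b [L LT ob] wab; apply: hh => //; exists L => //.
  by rewrite inE LT orbT.
have hcone v : hex_within x k v -> h v = h x + cone_max x v.
  move=> hv; have := @hexagon_const (fun v => h v - cone_max x v) x k v _ hv.
  rewrite cone_max_center subr0 => <-; first by rewrite subrK.
  move=> t i tH; have := @height_descent_uniq S TS ES h (cone_max x) t i hhS hS.
  by rewrite memS => /(_ tH); rewrite /descent; lra.
pose h1 v := if hex_within x k v then h x + 3 * k%:Z + cone_min x v else h v.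
have h1out t v : ~~ in_hexagon x k t -> v \in vertices t -> h1 v = h v.
  move=> tH vt; rewrite /h1; case: ifP => // hv.
  by have := cone_sphere tH vt hv; rewrite (hcone v hv); lra.
have out t : t \notin D -> ~~ in_hexagon x k t.
  by apply: contraNN; exact: HD.
exists h1, h; split => //.
- move=> t i tD; split; last first.
    move=> nD; rewrite -descent_nb /descent !(h1out (nb i t)) ?src_vertex ?dst_vertex ?out//.
    by have := (ah t i tD).2 nD; rewrite -descent_nb.
  have [tH|tH] := boolP (in_hexagon x k t).
    rewrite /descent /h1 !(in_hexagon_within tH) ?src_vertex ?dst_vertex//.
    by have := descent_cone_min x t i; rewrite /descent; lia.
  rewrite /descent !(h1out t) ?src_vertex ?dst_vertex//.
  exact: (ah t i tD).1.
(* [x0] belongs to a triangle outside [D], hence outside the hexagon, so its height is unchanged. *)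
- by rewrite (h1out s0) ?out.
- rewrite /h1 cone_min_center addr0 ifT; last by rewrite /hex_within; lia.
  by rewrite addrAC subrr add0r.
Qed.

Lemma height_valuesE x0 x m : height_values D x0 x m <->
  exists h, [/\ admissible D h, h x0 = 0 & h x = m].
Proof.
split=> [[T [h [DT hh h0 hm]]]|[h [ah h0 hm]]].
  by exists h; split => //; exact: (tiling_admissible DT hh).
have [T [DT hh]] := admissible_tiling ah.
by exists T, h.
Qed.

End Heights.

(** * Extremal heights and the largest hexagon *)

Lemma bounded_int_maximum (A : set int) (B m : int) : A m -> (forall z, A z -> z <= B) ->
  exists M, is_maximum A M.
Proof.
move=> Am AB.
have [n hn] : exists n : nat, B - m <= n%:Z by exists (absz (B - m)); lia.
elim: n m Am hn => [|n IHn] m Am hn.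
  by exists m; split => // z Az; have := AB z Az; lia.
have [[z [Az mz]]|nz] := pselect (exists z, A z /\ m < z); first by apply: (IHn z Az); lia.
exists m; split => // z Az; rewrite leNgt; apply/negP => mz.
by apply: nz; exists z.
Qed.

Theorem theorem4p3 (R : realType) (D : {fset triangle}) (x0 x : vertex) :
  simply_connected (@carrier R D) ->
  tileable D ->
  boundary_vertex D x0 ->
  vertex_of D x ->
  exists (hmax hmin : int) (c : nat),
    [/\ is_maximum (height_values D x0 x) hmax,
        is_minimum (height_values D x0 x) hmin,
        is_maximum (removable_hexagons D x) c
      & hmax - hmin = 3 * c%:Z].
Proof.
move=> sc [T DT] bx0 xD; have [x0D _] := bx0.
have [B hB] := admissible_bounded sc x0D xD.
have [h' hh'] := height_function_exists DT sc.
pose h v := h' v + - h' x0.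
have ah : admissible D h := admissible_shift (- h' x0) (tiling_admissible DT hh').
have hx0 : h x0 = 0 by rewrite /h subrr.
have bnd m : height_values D x0 x m -> `|m| <= B.
  by move=> /height_valuesE[g [ag g0 <-]]; have := hB g ag; rewrite g0 subr0.
have vh : height_values D x0 x (h x) by apply/height_valuesE; exists h.
have [M [VM Mu]] : exists M, is_maximum (height_values D x0 x) M.
  by apply: (@bounded_int_maximum _ B (h x)) => // z /bnd; lia.
(* The minimum is obtained as the maximum of the opposite values, so it is [- m']. *)
have [m' [Vm' mu']] : exists m, is_maximum [set z | height_values D x0 x (- z)]%classic m.
  apply: (@bounded_int_maximum _ B (- h x)) => /=; first by rewrite opprK.
  by move=> z /bnd; lia.
have mu z : height_values D x0 x z -> - m' <= z.
  move=> Vz; have : - z <= m' by apply: mu'; rewrite /= opprK.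
  lia.
have /height_valuesE[h1 [a1 h10 h1M]] := VM.
have /height_valuesE[h2 [a2 h20 h2m]] := Vm'.
have [z hz] : exists z, h1 x - h2 x = 3 * z.
  apply: (admissible_mod3 sc _ _ x0D xD); last by rewrite h10 h20.
    by move=> t i tD; exact: (a1 t i tD).1.
  by move=> t i tD; exact: (a2 t i tD).1.
have z0 : 0 <= z by have := mu _ VM; rewrite -h1M -h2m; lia.
exists M, (- m'), (absz z).
have gap : h1 x - h2 x = 3 * (absz z)%:Z by lia.
split => //; last by rewrite -h1M -h2m.
split.
  apply: (large_hexagon_removable sc a1 a2 xD _ gap) => v.
  by apply: (boundary_agree sc a1 a2 _ bx0); rewrite h10 h20.
(* A removable hexagon of side [k] yields two heights at [x] differing by [3k], which cannot exceed
   the extremal gap. *)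
move=> k /(removable_hexagon_heights sc bx0 xD)[g1 [g2 [b1 b2 g10 g20 gk]]].
have V1 : height_values D x0 x (g1 x) by apply/height_valuesE; exists g1.
have V2 : height_values D x0 x (g2 x) by apply/height_valuesE; exists g2.
have := Mu _ V1; have := mu _ V2; rewrite -h1M -h2m leEnat /=.
lia.
Qed.
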